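(* Let $0<\alpha\le1$, $m\in(0,1]$, and let $h$ be a non-negative $\mathbb{R}^{\alpha}$-valued function defined on a set containing $(0,1)$. Suppose $\mathcal{G}:I\subseteq\mathbb{R}\to\mathbb{R}^{\alpha}$ is local fractional continuous on the interior $I^{\circ}$, with local fractional derivative $\mathcal{G}^{(\alpha)}$, and let $\nu<\mu$ with $[\nu,\mu]\subseteq I$. Let $\mathcal{W}:[\nu,\mu]\to\mathbb{R}^{\alpha}$, $\mathcal{W}\ge0^{\alpha}$, be symmetric with respect to $\frac{\nu+\mu}{2}$ and local fractional continuous. Let $q\ge1$. If the mapping $\left|\mathcal{G}^{(\alpha)}\right|^{q}$ is generalized $(h-m)$-convex on $[\nu,\mu]$ (the convexity inequality being understood on a domain also containing $\frac{\nu+\mu}{2m}$), then $$\left|\frac{\mathcal{G}(\nu)+\mathcal{G}(\mu)}{2^{\alpha}}\,{}_{\nu}\mathcal{I}_{\mu}^{(\alpha)}\mathcal{W}(x)-{}_{\nu}\mathcal{I}_{\mu}^{(\alpha)}\bigl(\mathcal{W}(x)\mathcal{G}(x)\bigr)\right|\le\left(\frac{(\mu-\nu)^{2}}{4}\right)^{\alpha}\frac{\|\mathcal{W}\|_{\infty}}{\Gamma(\alpha+1)}\left(\frac{\Gamma(\alpha+1)}{\Gamma(2\alpha+1)}\right)^{1-\frac1q}\bigl(A_{\mu}^{1/q}+A_{\nu}^{1/q}\bigr),$$ where, for $c\in\{\nu,\mu\}$, $$A_{c}=\frac{\left|\mathcal{G}^{(\alpha)}(c)\right|^{q}}{\Gamma(\alpha+1)}\int_{0}^{1}\gamma^{\alpha}h(\gamma)(d\gamma)^{\alpha}+\frac{\left|\mathcal{G}^{(\alpha)}\left(\frac{\nu+\mu}{2m}\right)\right|^{q}}{\Gamma(\alpha+1)}\int_{0}^{1}\gamma^{\alpha}m^{\alpha}h(1-\gamma)(d\gamma)^{\alpha},$$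 and $\|\mathcal{W}\|_{\infty}=\sup_{\gamma\in[\nu,\mu]}\mathcal{W}(\gamma)$.
   Context: For $0<\alpha\le1$, $\mathbb{R}^{\alpha}$ is Yang's fractal set of $\alpha$-type real numbers $a^{\alpha}$ ($a\in\mathbb{R}$), with $a^{\alpha}+b^{\alpha}=(a+b)^{\alpha}$ and $a^{\alpha}b^{\alpha}=(ab)^{\alpha}$ (both operations commutative and associative, multiplication distributing over addition, neutral elements $0^{\alpha}$ and $1^{\alpha}$), ordered by $a^{\alpha}\le b^{\alpha}$ iff $a\le b$. Local fractional continuity of $\mathcal{G}$ at $\zeta_0$: for every $\varepsilon>0$ there is $\varrho>0$ such that $|\mathcal{G}(\zeta)-\mathcal{G}(\zeta_0)|<\varepsilon^{\alpha}$ whenever $|\zeta-\zeta_0|<\varrho$. Local fractional derivative (Yang): $\mathcal{G}^{(\alpha)}(x_0)=\lim_{x\to x_0}\Gamma(1+\alpha)\,(\mathcal{G}(x)-\mathcal{G}(x_0))/(x-x_0)^{\alpha}$. Local fractional integral: for $\mathcal{G}$ on $[\nu,\mu]$, $${}_{\nu}\mathcal{I}_{\mu}^{(\alpha)}\mathcal{G}(x)=\frac{1}{\Gamma(\alpha+1)}\int_{\nu}^{\mu}\mathcal{G}(\lambda)(d\lambda)^{\alpha}=\frac{1}{\Gamma(\alpha+1)}\lim_{\Delta\lambda\to0}\sum_{j=0}^{N-1}\mathcal{G}(\lambda_j)(\Delta\lambda_j)^{\alpha},$$ where $\nu=\lambda_0<\lambda_1<\dots<\lambda_N=\mu$ is a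 partition, $\Delta\lambda_j=\lambda_{j+1}-\lambda_j$ and $\Delta\lambda=\max_j\Delta\lambda_j$. Generalized $(h-m)$-convexity: a function $\mathcal{F}$ with values in $\mathbb{R}^{\alpha}$ is generalized $(h-m)$-convex (with $h\ge0^{\alpha}$, $m\in[0,1]$) if it is positive (in the sense $\mathcal{F}\ge0^{\alpha}$) and $\mathcal{F}(\gamma u+m(1-\gamma)v)\le h(\gamma)\mathcal{F}(u)+m^{\alpha}h(1-\gamma)\mathcal{F}(v)$ for all $u,v$ in the domain under consideration and all $\gamma\in(0,1)$. (The paper defines this for domain $[0,b]$.) *)

(* Defs.v *)
From HB Require Import structures.
From mathcomp Require Import all_boot all_order all_algebra.
From mathcomp Require Import all_classical all_reals all_analysis.

Set Implicit Arguments.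
Unset Strict Implicit.
Unset Printing Implicit Defensive.

Import Order.TTheory GRing.Theory Num.Theory.
Import numFieldNormedType.Exports.

Local Open Scope classical_set_scope.
Local Open Scope ring_scope.

(* Yang's fractal set R^alpha. Its element a^alpha is represented by its base
   a, so that a^alpha + b^alpha = (a + b)^alpha, a^alpha b^alpha = (ab)^alpha
   and a^alpha <= b^alpha iff a <= b are the operations and the order of R;
   the norm, sup and topology are the ones of that ordered field, whose balls
   are { |y - x| < eps^alpha }. *)
Definition fractal (R : realType) (alpha : R) : Type := R.

HB.instance Definition _ (R : realType) (alpha : R) :=
  Real.copy (fractal alpha) R.

Section Fractal.
Context (R : realType) (alpha : R).
Local Notation Ra := (fractal alpha).
Implicit Types (a b x q m : R) (A D I : set R) (G f h : R -> Ra) (u : Ra).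

(* the element a^alpha *)
Definition fpow a : Ra := a.

Definition fbase u : R := u.

(* (a^alpha)^q = (a^q)^alpha, for a >= 0 *)
Definition fexp u q : Ra := fpow (fbase u `^ q).

(* A nonnegative real number c, such as a value of the Gamma function, is
   identified with the element (c^(1/alpha))^alpha. Thus fpow a is identified
   with the real number a^alpha for a >= 0 (fscal_powR), and c * u is the
   product in R^alpha (fscalM). Negative c are not meant. *)
Definition fscal (c : R) : Ra := fpow (c `^ alpha^-1).

Lemma fscal_powR a : alpha != 0 -> 0 <= a -> fscal (a `^ alpha) = fpow a.
Proof. by move=> a0 ge0; rewrite /fscal -powRrM divff// powRr1. Qed.

Lemma fscalM c d : 0 <= c -> 0 <= d -> fscal (c * d) = fscal c * fscal d.
Proof. by move=> c0 d0; rewrite /fscal powRM. Qed.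

(* Euler's integral; meaningful for x > 0 *)
Definition Gamma x : R :=
  (\int[lebesgue_measure]_(t in `]0, +oo[) (t `^ (x - 1) * expR (- t)))%R.

(* Continuity at z0 of G, seen as a function with domain A *)
Definition lf_continuous_at A G (z0 : R) : Prop :=
  forall eps, 0 < eps -> exists2 rho : R, 0 < rho &
    forall z, A z -> `|z - z0| < rho -> `|G z - G z0| < fpow eps.

(* The limit is taken along the domain I of G: it is one-sided at an end point
   of I, and two-sided in the interior. *)
Definition lf_quotient G (x0 x : R) : Ra :=
  fscal (Gamma (1 + alpha)) * (G x - G x0) / fpow (x - x0).

Definition lf_derivable I G (x0 : R) : Prop :=
  limit_point I x0 /\ cvg (lf_quotient G x0 x @[x --> within I x0^']).

Definition lf_derive I G (x0 : R) : Ra :=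
  lim (lf_quotient G x0 x @[x --> within I x0^']).

(* A partition a = l_0 < l_1 < ... < l_N = b is given by s = [:: l_1; ...; l_N];
   the sums are evaluated at the left end points. *)
Definition lf_sum a (s : seq R) f : Ra :=
  \sum_(0 <= j < size s)
     f (nth 0 (a :: s) j) * fpow (nth 0 (a :: s) j.+1 - nth 0 (a :: s) j).

Definition mesh_lt a (s : seq R) (delta : R) : Prop :=
  forall j, (j < size s)%N ->
    nth 0 (a :: s) j.+1 - nth 0 (a :: s) j < delta.

Definition is_lf_int f a b (l : Ra) : Prop :=
  forall eps, 0 < eps -> exists2 delta : R, 0 < delta &
    forall s, itv_partition a b s -> mesh_lt a s delta ->
      `|lf_sum a s f - l| < fpow eps.

Definition lf_integrable f a b : Prop := exists l, is_lf_int f a b l.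

(* the bare integral \int_a^b f(x) (dx)^alpha, without the factor
   1 / Gamma(1 + alpha) *)
Definition lf_int f a b : Ra := xget 0 [set l | is_lf_int f a b l].

Definition lf_I f a b : Ra := lf_int f a b / fscal (Gamma (alpha + 1)).

(* D need not be stable under (u, v) |-> g u + m (1 - g) v, hence the last
   membership condition, which is automatic for D = [0, b]. *)
Definition hm_convex D h m (F : R -> Ra) : Prop :=
  (forall x, D x -> 0 <= F x) /\
  forall u v g, D u -> D v -> 0 < g < 1 -> D (g * u + m * (1 - g) * v) ->
    F (g * u + m * (1 - g) * v) <= h g * F u + fpow m * h (1 - g) * F v.

Definition supnorm (W : R -> Ra) a b : Ra := sup [set W x | x in `[a, b]].

End Fractal.

(* Main.v *)
Require Import Defs.
From HB Require Import structures.
From mathcomp Require Import all_boot all_order all_algebra.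
From mathcomp Require Import all_classical all_reals all_analysis.
From mathcomp Require Import measurable_realfun zify ring lra.

Set Implicit Arguments.
Unset Strict Implicit.
Unset Printing Implicit Defensive.

Import Order.TTheory GRing.Theory Num.Theory.
Import numFieldNormedType.Exports.

Local Open Scope classical_set_scope.
Local Open Scope ring_scope.

(** In the base representation the operations of the fractal set are those of
    the field of reals, so the local fractional derivative of [G] is [k] times
    its ordinary derivative, where [k] is the element [Gamma (alpha + 1)], that
    is the real [Gamma (alpha + 1) `^ alpha^-1], and the local fractional
    integral is [k^-1] times a limit of left Riemann sums.

    Write [mid] for the midpoint of [[nu, mu]] and set
    [u_c t = G (t * c + (1 - t) * mid)] for [c = nu] and [c = mu]. By the
    symmetry of [W], the points at equal distance from [mid] can be paired, and
    the difference to be bounded becomes the integral over half of the interval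
    of [W] times [(u_nu 1 - u_nu t) + (u_mu 1 - u_mu t)]
    ([trapezoid_estimate]). It remains to bound the mean of [`|u_c t - u_c 1|]
    over [0 < t < 1]. Formally this mean is at most the integral of
    [t * `|u_c' t|], the power mean inequality with the weight [t], of total
    mass [1 / 2], bounds the latter through the integral of
    [t * `|u_c' t| `^ q], and the convexity of [`|G'| `^ q] bounds the last one
    by [A c] up to constants ([half_bound]).

    The derivative of [G] need not be integrable, and the functions of [h] that
    are assumed integrable may be unbounded near [1], hence the integrals above
    are only formal. The argument is carried out on Riemann sums
    ([half_estimate]): the increments of [u_c] over the cells of a uniform
    partition are values of [u_c'] by the mean value theorem, at tags that
    cannot be chosen. Sums over arbitrary tags are bounded by the limit of the
    left sums because a tag can be inserted in a partition, where it becomes a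
    left end point ([tag_excess], [uniform_tags_le]). The last cell, where an
    integrable function may blow up, is left to the continuity of [u_c] at [1].

    This gives the constant [(2 * k)^-1 `^ (1 - q^-1)] instead of the power of
    [Gamma (alpha + 1) / Gamma (2 * alpha + 1)] of the theorem. The former is
    at most the latter because
    [Gamma (2 * alpha + 1) <= 2 `^ alpha * Gamma (alpha + 1) ^+ 2], with
    equality at [alpha = 1] ([Gamma_double_le]). To see this, put
    [P x = Gamma (x + a) ^+ 2 / (Gamma x * Gamma (x + 2 * a))]. The functional
    equation gives [P x = x * (x + 2 * a) / (x + a) ^+ 2 * P (x + 1)], Bernoulli's
    inequality bounds this factor below by the [a]-th power of its value at
    [a = 1], the product of these values telescopes to [1 / 2], and [P x] tends
    to [1] by the logarithmic convexity of Gamma. *)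

(** * The inequality between values of the Gamma function *)

Section GammaFunction.
Context {R : realType}.
Implicit Types (x t a : R) (n : nat).
Local Notation mu := lebesgue_measure.
Local Notation Gamma := (@Gamma R).

(** Bernoulli's inequality; with [t = expR L] it is the weighted sum of the
    inequalities [1 + y <= expR y] at [y = - a * L] and [y = (1 - a) * L]. *)
Lemma powR_le_tangent t a : 0 <= t -> 0 <= a <= 1 -> t `^ a <= 1 + a * (t - 1).
Proof.
move=> t0 /andP[a0 a1]; have [->|tn0] := eqVneq t 0.
  have [->|an0] := eqVneq a 0; first by rewrite powRr0 mul0r addr0.
  by rewrite powR0// sub0r mulrN1 subr_ge0.
have tp : 0 < t by rewrite lt_neqAle eq_sym tn0.
rewrite /powR (negPf tn0) -{2}(lnK tp); set L := ln t.
have eaL := expR_gt0 (a * L).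
have -> : expR L = expR (a * L) * expR ((1 - a) * L).
  by rewrite -expRD -mulrDl subrKC mul1r.
have e1 : 1 - a * L <= (expR (a * L))^-1.
  by rewrite -expRN; apply: le_trans (expR_ge1Dx _); rewrite lexx.
have e2 := expR_ge1Dx ((1 - a) * L).
have e3 : expR (a * L) * (1 - a * L) <= 1 by rewrite mulrC -ler_pdivlMr// mul1r.
have e4 : (1 - a) * (expR (a * L) * (1 - a * L)) <= (1 - a) * 1.
  by rewrite ler_wpM2l// subr_ge0.
have e5 : a * (expR (a * L) * (1 + (1 - a) * L)) <= a * (expR (a * L) * expR ((1 - a) * L)).
  by rewrite ler_wpM2l// ler_pM2l.
by lra.
Qed.

Lemma is_derive_powR x t : 0 < t -> is_derive t 1 (@powR R ^~ x) (x * t `^ (x - 1)).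
Proof.
move=> t0; have td : t \in `]0, +oo[ by rewrite in_itv/= t0.
apply: DeriveDef; first exact: derivable_powR.
by rewrite -derive1E powR_derive1.
Qed.

Local Notation kern x := (fun t => t `^ (x - 1) * expR (- t)).

Lemma kern_ge0 x t : 0 <= kern x t.
Proof. by rewrite mulr_ge0// ?powR_ge0 ?expR_ge0. Qed.

(** Half of the exponential absorbs the power, since
    [expR (t / 2) = expR (t / (2 * x)) `^ x >= (1 + t / (2 * x)) `^ x]. *)
Lemma kern_le_expR x t : 1 <= x -> 0 <= t ->
  kern x t <= (2 * x) `^ x * expR (- (t / 2)).
Proof.
move=> x1 t0; have x0 : 0 < x by lra.
have -> : - t = - (t / 2) + - (t / 2) by lra.
rewrite expRD mulrA ler_wpM2r ?expR_ge0//.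
rewrite expRN ler_pdivrMr ?expR_gt0//.
have -> : t / 2 = t / (2 * x) * x by field; rewrite gt_eqF.
rewrite expRM -powRM ?expR_ge0//; last by lra.
have le1 : 2 * x + t <= 2 * x * expR (t / (2 * x)).
  have -> : 2 * x + t = 2 * x * (1 + t / (2 * x)) by field; rewrite gt_eqF.
  by rewrite ler_wpM2l ?expR_ge1Dx//; lra.
apply: (@le_trans _ _ ((2 * x + t) `^ (x - 1))).
  by rewrite ge0_ler_powR ?nnegrE//; lra.
apply: (@le_trans _ _ ((2 * x + t) `^ x)); first by rewrite ler_powR; lra.
by rewrite ge0_ler_powR ?nnegrE//; lra.
Qed.

Lemma cvg_kern_pinfty x : 1 <= x -> kern x t @[t --> +oo] --> 0.
Proof.
move=> x1; have h0 : (2 * x) `^ x * expR (- (t / 2)) @[t --> +oo] --> 0.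
  rewrite -[X in _ --> X](mulr0 ((2 * x) `^ x)); apply: cvgM; first exact: cvg_cst.
  apply: (@cvg_comp _ _ _ (fun t => t / 2) (fun t => expR (- t)) _ +oo); last exact: cvgr_expR.
  by apply: gt0_cvgMly; rewrite ?invr_gt0.
apply: (@squeeze_cvgr _ _ _ _ (cst 0)
  (fun t => (2 * x) `^ x * expR (- (t / 2)))) => //; last exact: cvg_cst.
near=> t; rewrite kern_ge0 kern_le_expR//.
Unshelve. all: by end_near. Qed.

Lemma continuous_kern x : 1 <= x -> {within `[0, +oo[, continuous (kern x)}.
Proof.
move=> x1; apply/continuous_within_itvcyP; split.
  move=> t; rewrite in_itv/= andbT => t0.
  apply: differentiable_continuous; apply/derivable1_diffP.
  apply: derivableM; last exact: ex_derive.
  by apply: derivable_powR; rewrite in_itv/= t0.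
apply: cvgM; last first.
  apply: cvg_at_right_filter; apply: continuous_comp; last exact: continuous_expR.
  exact: opp_continuous.
have [->|xn1] := eqVneq x 1.
  by rewrite subrr powRr0; under eq_fun do rewrite powRr0; exact: cvg_cst.
rewrite powR0 ?subr_eq0//; apply: powR_cvg0; lra.
Qed.

Lemma measurable_kern x (D : set (measurableTypeR R)) : measurable_fun D (kern x).
Proof.
apply: measurable_funM; apply: measurable_funTS; first exact: measurable_powR.
by apply: measurableT_comp => //; exact: measurable_expR.
Qed.

Lemma integrable_expR_half (C : R) : 0 <= C ->
  mu.-integrable `[0, +oo[ (EFin \o (fun t => C * expR (- (t / 2)))).
Proof.
move=> C0; apply/integrableP; split.
  apply/measurable_EFinP; apply: measurable_funM => //; apply: measurable_funTS.
  apply: (measurableT_comp (@measurable_expR R)).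
  by apply: continuous_measurable_fun => t; apply: cvgN; apply: cvgM => //; exact: cvg_cst.
rewrite (@eq_integral _ _ _ mu _ (fun t => (C * expR (- (t / 2)))%:E)); last first.
  by move=> t _; rewrite /= ger0_norm// mulr_ge0// expR_ge0.
have dF t : is_derive t 1 (fun t : R => - (2 * C) * expR (- (t / 2))) (C * expR (- (t / 2))).
  by apply: is_derive_eq; rewrite /GRing.scale/=; field.
have cF : continuous (fun t : R => - (2 * C) * expR (- (t / 2))).
  by move=> t; apply: differentiable_continuous; apply/derivable1_diffP; case: (dF t).
rewrite (@ge0_continuous_FTC2y R _ (fun t => - (2 * C) * expR (- (t / 2))) 0 0) ?ltry//.
- by move=> t _; rewrite mulr_ge0// expR_ge0.
- apply: continuous_subspaceT => t.
  apply: cvgM; first exact: cvg_cst.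
  apply: continuous_comp; last exact: continuous_expR.
  by apply: cvgN; apply: cvgM => //; exact: cvg_cst.
- rewrite -[X in _ --> X](mulr0 (- (2 * C))); apply: cvgM; first exact: cvg_cst.
  apply: (@cvg_comp _ _ _ (fun t => t / 2) (fun t => expR (- t)) _ +oo); last exact: cvgr_expR.
  by apply: gt0_cvgMly; rewrite ?invr_gt0.
- exact: cvg_at_right_filter (cF 0).
- by move=> t _; rewrite derive1E; apply: derive_val.
Qed.

Lemma integrable_kern x : 1 <= x -> mu.-integrable `[0, +oo[ (EFin \o kern x).
Proof.
move=> x1; apply: (le_integrable _ _ _ (integrable_expR_half (powR_ge0 (2 * x) x))) => //.
  apply/measurable_EFinP; exact: measurable_kern.
move=> t; rewrite /= in_itv/= andbT => t0.
have le := kern_le_expR x1 t0.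
by rewrite lee_fin (ger0_norm (kern_ge0 x t)) ger0_norm// (le_trans (kern_ge0 x t)).
Qed.

Lemma GammaE x : 1 <= x -> Gamma x = \int[mu]_(t in `[0, +oo[) kern x t.
Proof.
move=> x1; rewrite /Gamma; apply: Rintegral_itv_obnd_cbnd.
apply: integrableS (integrable_kern x1) => //.
by apply: subset_itvr; rewrite bnd_simp.
Qed.

Lemma Gamma_ge0 x : 0 <= Gamma x.
Proof. by apply: Rintegral_ge0 => t _; exact: kern_ge0. Qed.

Lemma is_derive_powR_expRN x t : 0 < t ->
  is_derive t 1 (fun t => - (t `^ x * expR (- t))) (kern (x + 1) t - x * kern x t).
Proof.
move=> t0; have d1 := is_derive_powR x t0.
by apply: is_derive_eq; rewrite /GRing.scale/= addrK; ring.
Qed.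

(** Integration by parts: [- t `^ x * expR (- t)] is a primitive of the
    difference of the two kernels. The fundamental theorem on a half-line asks
    for an integrand of constant sign; the difference changes sign at [t = x],
    whence the cut there. *)
Lemma GammaS x : 1 <= x -> Gamma (x + 1) = x * Gamma x.
Proof.
move=> x1; have x0 : 0 < x by lra.
have x2 : 1 <= x + 1 by lra.
apply/eqP; rewrite -subr_eq0 !GammaE// -RintegralZl ?integrable_kern//.
have iK1 := integrable_kern x2.
have iZ : mu.-integrable `[0, +oo[ (EFin \o (fun t => x * kern x t)).
  exact: (integrableZl _ _ (integrable_kern x1)).
rewrite -(RintegralB _ iK1 iZ)//.
set f := (fun t => kern (x + 1) t - x * kern x t).
have iF : mu.-integrable `[0, +oo[ (EFin \o f) by exact: (integrableB _ iK1 iZ).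
pose F t := - (t `^ x * expR (- t)).
have dF t : 0 < t -> is_derive t 1 F (f t) by exact: is_derive_powR_expRN.
have fE t : 0 <= t -> f t = kern x t * (t - x).
  move=> t0; rewrite /f addrK; have [->|tn0] := eqVneq t 0.
    rewrite powR0 ?gt_eqF// oppr0 expR0.
    have [->|xn1] := eqVneq x 1; first by rewrite subrr powRr0; lra.
    by rewrite powR0 ?subr_eq0//; lra.
  have -> : t `^ x = t * t `^ (x - 1) by rewrite mulr_powRB1.
  by ring.
have cF : {within `[0, +oo[, continuous F}.
  apply/continuous_within_itvcyP.
  have /continuous_within_itvcyP[c1 c2] := continuous_kern x2.
  have FE : F = (fun t => - kern (x + 1) t) by apply/funext => t; rewrite /F addrK.
  by rewrite FE; split => [t t0|]; apply: cvgN; [exact: c1|exact: c2].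
have cf : {within `[0, +oo[, continuous f}.
  apply/continuous_within_itvcyP.
  have /continuous_within_itvcyP[c1 c2] := continuous_kern x2.
  have /continuous_within_itvcyP[c3 c4] := continuous_kern x1.
  split => [t t0|]; apply: cvgB; [exact: c1| |exact: c2|];
   (apply: cvgM; [exact: cvg_cst|]); [exact: c3|exact: c4].
have I1 : \int[mu]_(t in `[0, x]) f t = F x - F 0.
  rewrite /Rintegral (@continuous_FTC2 R f F)//.
  - apply: continuous_subspaceW cf.
    by apply: subset_itvl; rewrite bnd_simp.
  - have : {within `[0, x], continuous F}.
      by apply: continuous_subspaceW cF; apply: subset_itvl; rewrite bnd_simp.
    move/(continuous_within_itvP F x0) => [_ ? ?]; split => // t.
    rewrite in_itv/= => /andP[t0 _]; by case: (dF t t0).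
  - by move=> t; rewrite in_itv/= => /andP[t0 _]; rewrite derive1E; case: (dF t t0).
have I2 : \int[mu]_(t in `[x, +oo[) f t = 0 - F x.
  apply: (Rintegral_ge0_continuous_FTC2y (F := F)).
  - move=> t xt; rewrite fE; last by lra.
    by apply: mulr_ge0; [exact: kern_ge0|rewrite subr_ge0].
  - apply: continuous_subspaceW cf.
    by apply: subset_itvr; rewrite bnd_simp ltW.
  - rewrite -[X in _ --> X]oppr0; apply: cvgN.
    by have := cvg_kern_pinfty x2; under eq_fun do rewrite addrK.
  - by move=> t xt; case: (dF t (lt_trans x0 xt)).
  - apply: cvg_at_right_filter; apply: differentiable_continuous.
    by apply/derivable1_diffP; case: (dF x x0).
  - move=> t; rewrite in_itv/= andbT => xt; rewrite derive1E.
    by case: (dF t (lt_trans x0 xt)).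
rewrite (_ : \int[mu]_(_ in _) _ = \int[mu]_(t in `[0, x]) f t + \int[mu]_(t in `[x, +oo[) f t).
  by rewrite I1 I2 (_ : F 0 = 0) ?subr0 ?sub0r ?subrr// /F powR0 ?gt_eqF// mul0r oppr0.
have := @Rintegral_itvB R f (BLeft 0) (BInfty _ false) x iF.
rewrite !bnd_simp => /(_ (ltW x0) isT) H.
rewrite -(@Rintegral_itv_obnd_cbnd R x); first by rewrite -H [RHS]addrC subrK.
by apply: integrableS iF => //; apply: subset_itvr; rewrite bnd_simp ltW.
Qed.

Lemma Gamma1 : Gamma 1 = 1.
Proof.
rewrite GammaE//.
rewrite (Rintegral_ge0_continuous_FTC2y (F := fun t => - expR (- t)) (l := 0)).
- by rewrite oppr0 expR0 sub0r opprK.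
- by move=> t _; exact: kern_ge0.
- exact: continuous_kern.
- by rewrite -oppr0; apply: cvgN; exact: cvgr_expR.
- by move=> t _; exact: ex_derive.
- have cE : continuous (fun t : R => - expR (- t)).
    by move=> t; apply: differentiable_continuous; apply/derivable1_diffP; exact: ex_derive.
  exact: cvg_at_right_filter (cE 0).
- move=> t _; rewrite derive1E derive_val /GRing.scale/= subrr powRr0; ring.
Qed.

(** This form of the logarithmic convexity of Gamma is the tangent line of
    [t `^ a] at [t = x], integrated against the kernel. *)
Lemma Gamma_addr_le x a : 1 <= x -> 0 <= a <= 1 -> Gamma (x + a) <= x `^ a * Gamma x.
Proof.
move=> x1 a01; have /andP[a0 a1] := a01.
have x0 : 0 < x by lra.
have xa1 : 1 <= x + a by lra.
have x2 : 1 <= x + 1 by lra.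
have -> : x `^ a * Gamma x = x `^ a * (1 - a) * Gamma x + x `^ a * a / x * Gamma (x + 1).
  by rewrite GammaS//; field; rewrite gt_eqF.
have key (t : R) : 0 <= t -> kern (x + a) t <=
    x `^ a * (1 - a) * kern x t + x `^ a * a / x * kern (x + 1) t.
  move=> t0.
  rewrite !mulrA -mulrDl ler_wpM2r ?expR_ge0//.
  have [->|tn0] := eqVneq t 0.
    have rhs0 : 0 <= x `^ a * (1 - a) * 0 `^ (x - 1) + x `^ a * a / x * 0 `^ (x + 1 - 1).
      by rewrite addr_ge0// !mulr_ge0 ?powR_ge0 ?invr_ge0//; lra.
    have [xa|xa] := eqVneq (x + a - 1) 0; last by rewrite powR0.
    have [-> ->] : x = 1 /\ a = 0 by split; lra.
    by rewrite !(addr0, subrr, subr0, powRr0, mulr0, mul0r, mulr1).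
  have tp : 0 < t by rewrite lt_neqAle eq_sym tn0.
  have := powR_le_tangent (divr_ge0 t0 (ltW x0)) a01.
  rewrite addrK -(mulr_powRB1 _ x0)// => H.
  have -> : t `^ (x + a - 1) = t `^ a * t `^ (x - 1).
    by rewrite -powRD ?tn0 ?implybT//; congr (_ `^ _); lra.
  have -> : t `^ a = x `^ a * (t / x) `^ a.
    by rewrite -powRM ?divr_ge0 ?ltW// mulrC divfK// gt_eqF.
  have -> : x `^ a * (1 - a) * t `^ (x - 1) + x `^ a * a / x * (t * t `^ (x - 1)) =
     x `^ a * (1 + a * (t / x - 1)) * t `^ (x - 1) by field; rewrite gt_eqF.
  by rewrite ler_wpM2r ?powR_ge0// ler_wpM2l ?powR_ge0.
have i1 := integrable_kern x1.
have i2 := integrable_kern x2.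
have iZ1 (c : R) : mu.-integrable `[0, +oo[ (EFin \o (fun t => c * kern x t)).
  exact: (integrableZl _ _ i1).
have iZ2 (c : R) : mu.-integrable `[0, +oo[ (EFin \o (fun t => c * kern (x + 1) t)).
  exact: (integrableZl _ _ i2).
rewrite !GammaE// -!RintegralZl//.
rewrite -(RintegralD _ (iZ1 _) (iZ2 _))//.
apply: le_Rintegral => //; first exact: integrable_kern.
  exact: (integrableD _ (iZ1 _) (iZ2 _)).
by move=> t; rewrite /= in_itv/= andbT; exact: key.
Qed.

(** The next natural number [n.+1] after [x] is at distance at most [1], and
    [Gamma_addr_le] bounds the factorial [Gamma n.+1] by a multiple of
    [Gamma x]. *)
Lemma Gamma_gt0 x : 1 <= x -> 0 < Gamma x.
Proof.
move=> x1; have Gnat n : 0 < Gamma n.+1%:R.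
  elim: n => [|n IH]; first by rewrite Gamma1.
  by rewrite -natr1 GammaS ?mulr_gt0// ler1n.
have x0 : 0 <= x by lra.
have /andP[nx xn] := truncn_itv x0.
set n := Num.truncn x in nx xn.
have a01 : 0 <= n.+1%:R - x <= 1 by move: nx xn; rewrite -natr1; lra.
have := Gamma_addr_le x1 a01; rewrite addrC subrK => /(lt_le_trans (Gnat n)).
by rewrite pmulr_rgt0// powR_gt0//; lra.
Qed.

Definition Gamma_ratio a x := Gamma (x + a) ^+ 2 / (Gamma x * Gamma (x + 2 * a)).

Lemma Gamma_ratio_ge0 a x : 0 <= Gamma_ratio a x.
Proof.
apply: divr_ge0; first exact: sqr_ge0.
by apply: mulr_ge0; exact: Gamma_ge0.
Qed.

Lemma Gamma_ratioS a x : 0 <= a -> 1 <= x ->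
  Gamma_ratio a x = x * (x + 2 * a) / (x + a) ^+ 2 * Gamma_ratio a (x + 1).
Proof.
move=> a0 x1; have xa1 : 1 <= x + a by lra.
have w1 : 1 <= x + 2 * a by lra.
rewrite /Gamma_ratio (addrAC x 1 a) (addrAC x 1 (2 * a)).
rewrite (GammaS x1) (GammaS xa1) (GammaS w1).
move: (Gamma x) (Gamma_gt0 x1) (Gamma (x + 2 * a)) (Gamma_gt0 w1) (Gamma (x + a)).
move=> g1 g10 g2 g20 g3.
by field; rewrite !gt_eqF//; lra.
Qed.

(** By Bernoulli's inequality it is enough that
    [a ^+ 2 / (x + a) ^+ 2 <= a / (x + 1) ^+ 2], which follows from
    [a <= x ^+ 2]. *)
Lemma powR_factor_le a x : 0 <= a <= 1 -> 1 <= x ->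
  (x * (x + 2) / (x + 1) ^+ 2) `^ a <= x * (x + 2 * a) / (x + a) ^+ 2.
Proof.
move=> a01 x1; have /andP[a0 a1] := a01.
have t0 : 0 <= x * (x + 2) / (x + 1) ^+ 2.
  by rewrite divr_ge0 ?sqr_ge0// mulr_ge0; lra.
apply: le_trans (powR_le_tangent t0 a01) _.
have -> : 1 + a * (x * (x + 2) / (x + 1) ^+ 2 - 1) = 1 - a / (x + 1) ^+ 2.
  by field; lra.
have -> : x * (x + 2 * a) / (x + a) ^+ 2 = 1 - a ^+ 2 / (x + a) ^+ 2.
  by field; lra.
rewrite lerD2l lerN2 ler_pdivrMr ?exprn_gt0//; last by lra.
rewrite mulrAC ler_pdivlMr ?exprn_gt0//; last by lra.
have h : 0 <= a * (1 - a) * (x ^+ 2 - a) by rewrite !mulr_ge0//; nra.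
by nra.
Qed.

Lemma div_le_sqr_div (A B gx gy gw : R) : 0 < A -> 0 <= B -> 0 < gx -> 0 < gw ->
  gw <= A * gy -> B * gx <= gy -> B / A <= gy ^+ 2 / (gx * gw).
Proof.
move=> A0 B0 gx0 gw0 le1 le2; rewrite ler_pdivlMr ?mulr_gt0//.
have -> : B / A * (gx * gw) = (B * gx) * (gw / A) by field; rewrite gt_eqF.
rewrite expr2; apply: ler_pM => //.
- by rewrite mulr_ge0// ltW.
- by rewrite divr_ge0// ltW.
- by rewrite ler_pdivrMr// mulrC.
Qed.

(** Two instances of [Gamma_addr_le]: from [x + a] to [x + 2 * a], and from
    [x + a - 1] to [x]. The second one starts at [1] or more only if
    [2 <= x + a]. *)
Lemma Gamma_ratio_ge a x : 0 <= a <= 1 -> 2 <= x ->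
  ((x + a - 1) / (x + a)) `^ a <= Gamma_ratio a x.
Proof.
move=> a01 x2; have /andP[a0 a1] := a01.
have y1 : 1 <= x + a by lra.
have z1 : 1 <= x + a - 1 by lra.
have x1 : 1 <= x by lra.
have w1 : 1 <= x + 2 * a by lra.
have b01 : 0 <= 1 - a <= 1 by lra.
have y0 : 0 < x + a by lra.
have z0 : 0 < x + a - 1 by lra.
have wE : x + a + a = x + 2 * a by lra.
have xE : x + a - 1 + (1 - a) = x by lra.
have Gx := Gamma_gt0 x1; have Gy := Gamma_gt0 y1; have Gz := Gamma_gt0 z1.
have Gw := Gamma_gt0 w1.
have ub1 := Gamma_addr_le y1 a01.
rewrite wE in ub1.
have ub2 := Gamma_addr_le z1 b01.
rewrite xE in ub2.
have GyE : Gamma (x + a) = (x + a - 1) * Gamma (x + a - 1).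
  by rewrite -GammaS ?subrK.
have ub3 : (x + a - 1) `^ a * Gamma x <= Gamma (x + a).
  rewrite GyE; apply: le_trans (ler_wpM2l (powR_ge0 _ _) ub2) _.
  move: (Gamma (x + a - 1)) => g.
  rewrite mulrA -powRD ?(addrC a) ?subrK ?powRr1//; first exact: ltW.
  by rewrite (gt_eqF z0) implybT.
have -> : ((x + a - 1) / (x + a)) `^ a = (x + a - 1) `^ a / (x + a) `^ a.
  rewrite powRM ?invr_ge0; [|exact: ltW|exact: ltW].
  by rewrite -(powR_inv1 (ltW y0)) -powRrM mulN1r powRN.
exact: div_le_sqr_div (powR_gt0 _ y0) (powR_ge0 _ _) Gx Gw ub1 ub3.
Qed.

(** The factors [x * (x + 2) / (x + 1) ^+ 2] at [x = 1], ..., [n] telescope to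
    [(n + 2) / (2 * (n + 1))]. *)
Lemma Gamma_ratio1_ge a n : 0 <= a <= 1 ->
  (n.+2%:R / (2 * n.+1%:R)) `^ a * Gamma_ratio a n.+1%:R <= Gamma_ratio a 1.
Proof.
move=> a01; have /andP[a0 a1] := a01; elim: n => [|n IH].
  by rewrite mulr1 divff// powR1 mul1r.
apply: le_trans IH; rewrite [in leRHS]Gamma_ratioS ?ler1n// natr1 mulrA.
have n0 : 0 < n.+1%:R :> R by rewrite ltr0n.
apply: ler_wpM2r.
  exact: Gamma_ratio_ge0.
apply: le_trans (ler_wpM2l (powR_ge0 _ _) (powR_factor_le a01 _)); last by rewrite ler1n.
rewrite -powRM ?divr_ge0 ?mulr_ge0 ?sqr_ge0 ?ler0n ?addr_ge0//.
rewrite le_eqVlt; apply/orP; left; apply/eqP; congr (_ `^ a).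
rewrite -!(natr1 n.+2) -!(natr1 n.+1) ; field; rewrite ?gt_eqF//=; lra.
Qed.

(** Let [n] tend to infinity in [Gamma_ratio1_ge], with [Gamma_ratio_ge] as a
    lower bound of the remaining ratio; the [a]-th root [y] of the ratio at [1]
    turns the limit into one of rational functions of [n]. *)
Lemma Gamma_double_le a : 0 < a <= 1 ->
  Gamma (2 * a + 1) <= 2 `^ a * Gamma (a + 1) ^+ 2.
Proof.
move=> /andP[a0 a1]; have a01 : 0 <= a <= 1 by lra.
have w1 : 1 <= 2 * a + 1 by lra.
have Gw := Gamma_gt0 w1.
suff : 2^-1 `^ a <= Gamma_ratio a 1.
  rewrite /Gamma_ratio Gamma1 mul1r (addrC 1 a) (addrC 1 (2 * a)).
  move: (Gamma (2 * a + 1)) Gw (Gamma (a + 1)) => g1 g10 g2.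
  rewrite ler_pdivlMr// -(@powR_inv1 R 2)// -powRrM mulN1r powRN.
  by rewrite ler_pdivrMl ?powR_gt0.
have {Gw} r0 := Gamma_ratio_ge0 a 1.
pose y := Gamma_ratio a 1 `^ a^-1.
have yE : y `^ a = Gamma_ratio a 1 by rewrite -powRrM mulVf ?powRr1// gt_eqF.
have y0 : 0 <= y by exact: powR_ge0.
rewrite -yE ge0_ler_powR ?nnegrE ?invr_ge0//; first exact: ltW.
have yn n : 2^-1 * (1 - n.+2%:R^-1) <= y.
  have n0 : 0 <= n%:R :> R by rewrite ler0n.
  have nE : n.+2%:R = n%:R + 2 :> R by rewrite -!natr1; lra.
  have nE3 : n.+3%:R = n%:R + 3 :> R by rewrite -!natr1; lra.
  have h2 : 2 <= n.+2%:R :> R by rewrite ler_nat.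
  have h3 : 0 <= n.+2%:R + a - 1 by lra.
  have h4 : 0 <= n.+2%:R + a by lra.
  have := le_trans (ler_wpM2l (powR_ge0 _ _) (Gamma_ratio_ge a01 h2)) (Gamma_ratio1_ge n.+1 a01).
  rewrite -powRM; [|by rewrite divr_ge0// mulr_ge0|by rewrite divr_ge0].
  set t := (X in X `^ a <= _) => H.
  have t0 : 0 <= t by rewrite /t mulr_ge0// divr_ge0.
  apply: (@le_trans _ _ t); last first.
    have H' : (t `^ a) `^ a^-1 <= Gamma_ratio a 1 `^ a^-1.
      by rewrite ge0_ler_powR ?nnegrE ?powR_ge0// invr_ge0 ltW.
    by rewrite -powRrM mulfV ?powRr1// gt_eqF in H'.
  rewrite /t nE nE3 {H t t0}.
  set N : R := n%:R in n0 *.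
  have le1 : 1 - (N + 2)^-1 <= (N + 2 + a - 1) / (N + 2 + a).
    have -> : (N + 2 + a - 1) / (N + 2 + a) = 1 - (N + 2 + a)^-1 by field; lra.
    by rewrite lerD2l lerN2 lef_pV2 ?posrE; lra.
  have -> : (N + 3) / (2 * (N + 2)) = 2^-1 * (1 + (N + 2)^-1) by field; lra.
  have i0 : 0 <= (N + 2)^-1 by rewrite invr_ge0; lra.
  have i1 : (N + 2)^-1 <= 1 by rewrite invf_le1; lra.
  rewrite -mulrA ler_wpM2l ?invr_ge0//.
  apply: le_trans le1 _; rewrite -[leLHS]mul1r ler_wpM2r ?lerDl// divr_ge0; lra.
rewrite leNgt; apply/negP => y2.
have e0 : 0 < 1 - 2 * y by lra.
have := truncnS_gt (1 - 2 * y)^-1; set n := Num.truncn _ => nP.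
have := yn n; apply/negP; rewrite -ltNge.
have : n.+2%:R^-1 < 1 - 2 * y; last by move: (n.+2%:R^-1) => z; lra.
rewrite -[ltRHS]invrK ltf_pV2 ?posrE ?invr_gt0 ?ltr0n//.
by apply: lt_trans nP _; rewrite ltr_nat.
Qed.

End GammaFunction.

(** * Left Riemann sums and arbitrary tags *)

Section LeftSums.
Context {R : realType}.
Implicit Types (f : R -> R) (a b x : R) (s : seq R) (p xi : nat -> R) (S : pred nat).

Fixpoint lsum f a s : R :=
  if s is x :: s' then f a * (x - a) + lsum f x s' else 0.

Definition fine_step (delta : R) : rel R := [rel x y | (x < y) && (y - x < delta)].

Lemma lsum_cat f a s t : lsum f a (s ++ t) = lsum f a s + lsum f (last a s) t.
Proof. by elim: s a => [|x s IH] a /=; rewrite ?add0r// IH addrA. Qed.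

Lemma lsumE f a s :
  lsum f a s = \sum_(0 <= j < size s)
    f (nth 0 (a :: s) j) * (nth 0 (a :: s) j.+1 - nth 0 (a :: s) j).
Proof.
elim: s a => [|x s IH] a /=; first by rewrite big_nil.
by rewrite big_nat_recl//= IH.
Qed.

Lemma fine_stepP delta a b s :
  (itv_partition a b s /\ mesh_lt a s delta) <-> (path (fine_step delta) a s /\ last a s = b).
Proof.
split => [[[/(pathP 0) p /eqP l] m]|[/(pathP 0) p l]].
  by split => //; apply/(pathP 0) => i si; apply/andP; split; [exact: p|exact: m].
split; last by move=> i si; have /andP[] := p i si.
by split; [apply/(pathP 0) => i si; have /andP[] := p i si|exact/eqP].
Qed.

(** This is [is_lf_int] for functions with values in the field of reals: the
    operations of the fractal set are the same, whatever [alpha]. *)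
Definition left_int f a b l := forall eps : R, 0 < eps ->
  exists2 delta : R, 0 < delta &
    forall s, path (fine_step delta) a s -> last a s = b -> `|lsum f a s - l| < eps.

Lemma is_lf_intP (alpha : R) f a b (l : R) :
  is_lf_int (f : R -> fractal alpha) a b (l : fractal alpha) <-> left_int f a b l.
Proof.
split => H eps e0; have [d d0 Hd] := H eps e0; exists d => //.
  move=> s p la; have /fine_stepP[p1 p2] : path (fine_step d) a s /\ last a s = b by [].
  by have := Hd s p1 p2; rewrite lsumE.
move=> s p1 p2; have [p la] : path (fine_step d) a s /\ last a s = b by exact/fine_stepP.
by have := Hd s p la; rewrite lsumE.
Qed.

Fixpoint tagged p xi S n : seq R :=
  if n is n'.+1 then
    tagged p xi S n' ++ (if S n' then [:: xi n'; p n] else [:: p n])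
  else [::].

Lemma last_tagged p xi S n : last (p 0) (tagged p xi S n) = p n.
Proof. by case: n => //= n; rewrite last_cat; case: ifP. Qed.

Lemma path_tagged (delta : R) p xi S n :
  (forall i, (i < n)%N -> fine_step delta (p i) (p i.+1)) ->
  (forall i, (i < n)%N -> S i -> p i < xi i < p i.+1) ->
  path (fine_step delta) (p 0) (tagged p xi S n).
Proof.
elim: n => //= n IH Hp Hxi; rewrite cat_path last_tagged IH//=; last first.
- by move=> i ni; apply: Hxi; rewrite ltnW.
- by move=> i ni; apply: Hp; rewrite ltnW.
have /andP[p1 p2] := Hp n (ltnSn n).
case: ifP => [Sn|_] /=; last by rewrite andbT; exact: Hp.
have /andP[q1 q2] := Hxi n (ltnSn n) Sn.
by rewrite /fine_step/= q1 q2 /=; apply/and3P; split=> //; lra.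
Qed.

Lemma lsum_tagged f p xi S n : lsum f (p 0) (tagged p xi S n) =
  \sum_(i < n) f (p i) * (p i.+1 - p i)
  + \sum_(i < n | S i) (f (xi i) - f (p i)) * (p i.+1 - xi i).
Proof.
elim: n => [|n IH] /=; first by rewrite !big_ord0 addr0.
rewrite lsum_cat last_tagged IH ![\sum_(i < _ | S _) _]big_mkcond !big_ord_recr /=.
case: ifP => _ /=; ring.
Qed.

(** Inserting the tag [xi i] in its cell changes the left sum by
    [(f (xi i) - f (p i)) * (p i.+1 - xi i)]. Since the set [S] of cells is
    arbitrary, it can be chosen so that all these terms are nonnegative. *)
Lemma tag_excess f a b l : left_int f a b l ->
  forall eps : R, 0 < eps -> exists2 delta : R, 0 < delta &
    forall n p xi S, p 0 = a -> p n = b ->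
      (forall i, (i < n)%N -> fine_step delta (p i) (p i.+1)) ->
      (forall i, (i < n)%N -> S i -> p i < xi i < p i.+1) ->
      `|\sum_(i < n) f (p i) * (p i.+1 - p i) - l| < eps /\
      \sum_(i < n | S i) (f (xi i) - f (p i)) * (p i.+1 - xi i) <= eps.
Proof.
move=> H eps e0; have e20 : 0 < eps / 2 by lra.
have [d d0 Hd] := H (eps / 2) e20.
exists d => // n p xi S p0 pn pd pxi.
have h0 : \sum_(i < n | pred0 (i : nat)) (f (xi i) - f (p i)) * (p i.+1 - xi i) = 0.
  by rewrite big_pred0.
have := Hd (tagged p xi S n); have := Hd (tagged p xi pred0 n).
rewrite -p0 !last_tagged !lsum_tagged h0 addr0.
have pp0 : path (fine_step d) (p 0) (tagged p xi pred0 n) by exact: path_tagged.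
move=> /(_ pp0 pn) + /(_ (path_tagged pd pxi) pn).
rewrite !ltr_norml => /andP[? ?] /andP[? ?]; split; last by lra.
by apply/andP; split; lra.
Qed.

Lemma left_int_grid (f : R -> R) (a b l : R) : left_int f a b l ->
  forall eps : R, 0 < eps -> exists2 d : R, 0 < d &
    forall n (h : R), 0 < h -> h < d -> a + n%:R * h = b ->
      `|\sum_(i < n) f (a + i%:R * h) * h - l| < eps.
Proof.
move=> fl eps e0; have [d d0 dP] := tag_excess fl e0; exists d => // n h h0 hd ab.
pose p i := a + i%:R * h.
have pS i : p i.+1 - p i = h by rewrite /p -natr1; ring.
have [||//|] := dP n p p pred0 _ ab.
- by rewrite /p mul0r addr0.
- by move=> i _; rewrite /fine_step/= -subr_gt0 pS h0.
- by under eq_bigr do rewrite pS.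
Qed.

Lemma sum_even_odd (g : nat -> R) m :
  \sum_(j < (2 * m).+1) g j = \sum_(i < m.+1) g (2 * i)%N + \sum_(i < m) g (2 * i).+1.
Proof.
elim: m => [|m IH]; first by rewrite muln0 !big_ord_recr !big_ord0 /= add0r addr0.
rewrite mulnS !addSn add0n 2!big_ord_recr IH [in RHS]big_ord_recr /=.
rewrite [X in _ = _ + X]big_ord_recr /=.
rewrite mulnS !addSn add0n; ring.
Qed.

(** The excess in [tag_excess] is weighted by the distance from the tag to the
    next point, which can be much smaller than the cell. Therefore the cells are
    merged in pairs: in the partition by the points of even index, a tag of the
    first half of a double cell is at distance at least [N%:R^-1] from the next
    point, and the other tags are treated with the points of odd index. No
    double cell starts at the last point before [1], hence the last tag is
    missing from the sum. *)
Lemma uniform_tags_le f l : left_int f 0 1 l -> (forall x, 0 <= x < 1 -> 0 <= f x) ->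
  forall eps : R, 0 < eps -> exists M : nat, forall m N, (M <= m)%N -> N = (2 * m.+1)%N ->
    forall xi, (forall j, (j.+1 < N)%N -> j%:R / N%:R < xi j < j.+1%:R / N%:R) ->
    \sum_(j < N.-1) f (xi j) / N%:R <= l + eps.
Proof.
move=> fl f0 eps e0; have e30 : 0 < eps / 3 by lra.
have [d d0 Hd] := tag_excess fl e30.
exists (Num.truncn d^-1) => m _ Mm ->; set N := (2 * m.+1)%N.
(* The partition by odd points is 0, 1, 3, ..., N - 1, N; the predecessor is
   truncated at 0. *)
pose c i := minn (2 * i).-1 N.
have cS i : (i <= m)%N -> c i.+1 = (2 * i).+1 by rewrite /c /N; lia.
have cm : c m.+1 = N.-1 by rewrite /c /N; lia.
have cN : c m.+2 = N.-1.+1 by rewrite /c /N; lia.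
have ltN i : (i <= m)%N -> ((2 * i).+1 < (2 * m.+1))%N by lia.
have lt2N i : (i < m)%N -> ((2 * i).+3 < (2 * m.+1))%N by lia.
have mulS2 i : (2 * i.+1 = (2 * i).+2)%N by lia.
move=> xi xiP.
have NR : N%:R = 2 * (m%:R + 1) :> R by rewrite /N natrM natr1.
have m0 : 0 <= m%:R :> R by rewrite ler0n.
have N0 : 0 < N%:R :> R by rewrite ltr0n.
have dm : 2 / N%:R < d.
  rewrite NR; have -> : 2 / (2 * (m%:R + 1)) = (m%:R + 1)^-1 :> R by field; lra.
  have m10 : 0 < m%:R + 1 :> R by lra.
  rewrite -[ltRHS]invrK ltf_pV2 ?posrE ?invr_gt0//.
  by apply: lt_le_trans (truncnS_gt _) _; rewrite natr1 ler_nat ltnS.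
pose x j : R := j%:R / N%:R.
have xlt i j : (i < j)%N -> x i < x j by move=> ij; rewrite ltr_pM2r ?invr_gt0// ltr_nat.
have x0 : x 0%N = 0 by rewrite /x mul0r.
have xN : x N = 1 by rewrite /x divff// gt_eqF.
have xS j : x j.+1 = x j + N%:R^-1 by rewrite /x -natr1 mulrDl mul1r.
have Ni0 : 0 < N%:R^-1 :> R by rewrite invr_gt0.
have [grid _] : `|\sum_(i < N) f (x i) * (x i.+1 - x i) - l| < eps / 3 /\
    \sum_(i < N | pred0 (i : nat)) (f (xi i) - f (x i)) * (x i.+1 - xi i) <= eps / 3.
  by apply: Hd => // i _; rewrite /fine_step/= xlt//= xS; lra.
have {}grid : \sum_(i < N.-1) f (x i) / N%:R <= l + eps / 3.
  have gE : \sum_(i < N) f (x i) * (x i.+1 - x i) =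
      \sum_(i < N.-1) f (x i) / N%:R + f (x N.-1) / N%:R.
    rewrite -(@big_ord_recr _ _ _ N.-1 (fun i => f (x (i : nat)) / N%:R)).
    by apply: eq_bigr => i _; rewrite xS addrC addKr.
  have : 0 <= f (x N.-1) / N%:R.
    rewrite divr_ge0// f0// -xN xlt ?andbT// /x divr_ge0// ler0n.
  by move: grid; rewrite gE ltr_norml => /andP[_ ?]; lra.
pose pos j := Num.max 0 (f (xi j) - f (x j)).
have even : \sum_(i < m.+1) pos (2 * i)%N / N%:R <= eps / 3.
  pose p i := x (2 * i)%N.
  pose t i := xi (2 * i)%N.
  pose S i := f (p i) < f (t i).
  have tP i : (i < m.+1)%N -> p i < t i < x (2 * i).+1.
    by move=> im; exact/xiP/ltN.
  have pS i : x (2 * i).+1 = p i.+1 - N%:R^-1.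
    by rewrite /p mulS2 [x _.+2]xS addrK.
  have [|//|||_] := Hd m.+1 p t S.
  - by rewrite /p muln0.
  - by move=> i _; rewrite /fine_step/= /p mulS2 2!xS; lra.
  - by move=> i im _; have := tP i im; rewrite pS; lra.
  apply: le_trans; rewrite big_mkcond [leRHS]big_mkcond /=; apply: ler_sum => i _.
  have := tP i (ltn_ord i); rewrite /pos -/(p i) -/(t i) pS => /andP[_ ti].
  case: ifPn; rewrite /S => Si; last by rewrite max_l ?mul0r// subr_le0 leNgt.
  rewrite max_r ?subr_ge0 ?(ltW Si)//; apply: ler_wpM2l; last by lra.
  by rewrite subr_ge0 ltW.
have odd : \sum_(i < m) pos (2 * i).+1 / N%:R <= eps / 3.
  pose p i := x (c i).
  pose t i := xi (2 * i).-1.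
  pose S i := (0 < i < m.+1)%N && (f (p i) < f (t i)).
  have tP i : (i < m)%N -> p i.+1 < t i.+1 < p i.+2 - N%:R^-1.
    move=> im; rewrite /p !cS ?(ltnW im)// mulS2 [x _.+3]xS addrK /t mulS2.
    exact/xiP/ltnW/lt2N.
  have c0 : c 0%N = 0%N by rewrite /c muln0 min0n.
  have [||||_] := Hd m.+2 p t S.
  - by rewrite /p c0.
  - by rewrite /p cN.
  - move=> i im; rewrite /fine_step/= /p; case: i im => [|i] im.
      by rewrite c0 cS// muln0 xS x0; lra.
    move: im; rewrite !ltnS leq_eqVlt => /predU1P[->|im].
      by rewrite cN cm xS; lra.
    by rewrite !cS ?(ltnW im)// mulS2 [x _.+3]xS [x _.+2]xS; lra.
  - move=> [|i] im; rewrite /S//= => /andP[im2 _].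
    by have := tP i im2; lra.
  apply: le_trans; rewrite [leRHS]big_mkcond big_ord_recl big_ord_recr /=.
  have bE j : bump 0 j = j.+1 by [].
  have -> : S (bump 0 m) = false by rewrite bE /S ltnn andbF.
  rewrite add0r addr0; apply: ler_sum => i _; rewrite bE.
  have -> : S i.+1 = (f (p i.+1) < f (t i.+1)) by rewrite /S /= ltnS ltn_ord.
  have := tP i (ltn_ord i); rewrite /pos.
  have -> : x (2 * i).+1 = p i.+1 by rewrite /p cS// ltnW.
  have -> : xi (2 * i).+1 = t i.+1 by rewrite /t mulS2.
  move=> /andP[_ ti].
  case: ifPn => Si; last by rewrite max_l ?mul0r// subr_le0 leNgt.
  rewrite max_r ?subr_ge0 ?(ltW Si)//; apply: ler_wpM2l; last by lra.
  by rewrite subr_ge0 ltW.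
have N1 : N.-1 = (2 * m).+1 by rewrite /N mulnS.
rewrite N1 in grid *.
apply: (@le_trans _ _ (\sum_(j < (2 * m).+1) (f (x j) / N%:R + pos j / N%:R))).
  apply: ler_sum => j _; rewrite -mulrDl ler_wpM2r ?(ltW Ni0)//.
  by rewrite /pos -lerBlDl le_max lexx orbT.
rewrite big_split /= (sum_even_odd (fun j => pos j / N%:R)).
have -> : l + eps = (l + eps / 3) + (eps / 3 + eps / 3) by field.
by apply: lerD => //; exact: lerD.
Qed.

End LeftSums.

(** * The mean distance to the end value of a function with dominated derivative *)

(** An upper bound on the integral of [`|u t - u 1|] over [0 < t < 1], through
    Riemann sums. Their number [N] of cells is even because [uniform_tags_le]
    merges cells in pairs. *)
Definition uniform_dist_le {R : realType} (u : R -> R) (B : R) := forall eta : R, 0 < eta ->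
  exists M : nat, forall m N, (M <= m)%N -> N = (2 * m.+1)%N ->
    (\sum_(j < N.-1) `|u (j.+1%:R / N%:R) - u 1|) / N%:R <= B + eta.

Section HalfEstimate.
Context {R : realType}.
Implicit Types (f u du : R -> R).

Lemma powR_right_cont (t r eta : R) : 0 <= t -> 0 < r -> 0 < eta ->
  exists2 e : R, 0 < e & forall s, 0 <= s <= t + e -> s `^ r <= t `^ r + eta.
Proof.
move=> t0 r0 eta0; have tr0 := powR_ge0 t r.
exists ((t `^ r + eta) `^ r^-1 - t).
  rewrite subr_gt0 -[ltLHS]powRr1// -[X in _ `^ X < _](@mulfV _ r) ?gt_eqF// powRrM.
  by apply: gt0_ltr_powR; rewrite ?nnegrE ?invr_gt0//; lra.
move=> s; rewrite subrKC => /andP[s0 st].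
have -> : t `^ r + eta = ((t `^ r + eta) `^ r^-1) `^ r.
  by rewrite -powRrM mulVf ?powRr1 ?gt_eqF//; lra.
by apply: ge0_ler_powR; rewrite ?nnegrE ?powR_ge0// ltW.
Qed.

(** The tangent line of [t `^ q^-1] at [t = T] makes the power mean inequality
    linear in the two sums, so that upper bounds on them are enough. *)
Lemma power_mean_le (q T : R) n (w y : nat -> R) : 1 <= q -> 0 < T ->
  (forall i, 0 <= w i) -> (forall i, 0 <= y i) ->
  \sum_(i < n) w i <= 1 / 2 -> \sum_(i < n) w i * y i `^ q <= T / 2 ->
  \sum_(i < n) w i * y i <= T `^ q^-1 / 2.
Proof.
move=> q1 T0 w0 y0 sw swy.
have q0 : 0 < q by lra.
have iq : 0 <= q^-1 <= 1 by rewrite invr_ge0 ltW//= invf_le1.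
have c0 : 0 < T `^ q^-1 by rewrite powR_gt0.
set c := T `^ q^-1 in c0 *.
have tan i : y i <= c * (1 - q^-1) + c / q / T * y i `^ q.
  have := powR_le_tangent (divr_ge0 (powR_ge0 (y i) q) (ltW T0)) iq.
  rewrite powRM ?powR_ge0 ?invr_ge0 ?(ltW T0)//.
  have -> : T^-1 `^ q^-1 = c^-1 by rewrite -(powR_inv1 (ltW T0)) -powRrM mulN1r powRN.
  rewrite -powRrM mulfV ?gt_eqF// powRr1// ler_pdivrMr// => /le_trans; apply.
  rewrite le_eqVlt; apply/orP; left; apply/eqP; field.
  by rewrite !gt_eqF.
apply: (@le_trans _ _ (\sum_(i < n) (c * (1 - q^-1) * w i + c / q / T * (w i * y i `^ q)))).
  apply: ler_sum => i _.
  have := ler_wpM2l (w0 i) (tan i); move=> /le_trans; apply.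
  by rewrite le_eqVlt; apply/orP; left; apply/eqP; ring.
rewrite big_split/= -!mulr_sumr.
have k1 : 0 <= c * (1 - q^-1) by rewrite mulr_ge0 ?subr_ge0 ?(ltW c0)//; case/andP: iq.
have k2 : 0 <= c / q / T by rewrite !mulr_ge0 ?invr_ge0 ?ltW.
have := lerD (ler_wpM2l k1 sw) (ler_wpM2l k2 swy) => /le_trans; apply.
rewrite le_eqVlt; apply/orP; left; apply/eqP; field.
by rewrite !gt_eqF.
Qed.

(** Summation by parts: the increment from [a l] to [a l.+1] occurs in the
    distances to [a n] of the [l.+1] terms [a 0], ..., [a l]. *)
Lemma sum_dist_last_le (a : nat -> R) n :
  \sum_(j < n) `|a j - a n| <= \sum_(l < n) l.+1%:R * `|a l.+1 - a l|.
Proof.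
elim: n => [|n IH]; first by rewrite !big_ord0.
apply: (@le_trans _ _ (\sum_(j < n.+1) (`|a j - a n| + `|a n.+1 - a n|))).
  apply: ler_sum => j _; rewrite -[a n.+1 - a n]opprB normrN.
  by apply: le_trans (ler_normD _ _); rewrite addrA subrK.
rewrite big_split/= sumr_const card_ord !big_ord_recr/= subrr normr0 addr0.
by rewrite -[X in _ + X <= _]mulr_natl lerD2r.
Qed.

Lemma left_int_ge0 f l : left_int f 0 1 l -> (forall x : R, 0 <= x < 1 -> 0 <= f x) -> 0 <= l.
Proof.
move=> fl f0; apply/ler_addgt0Pr => e e0.
have [M /(_ M _ (leqnn M) erefl)] := uniform_tags_le fl f0 e0.
set N := (2 * M.+1)%N => H.
have N0 : 0 < N%:R :> R by rewrite ltr0n.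
have Ni0 : 0 < N%:R^-1 :> R by rewrite invr_gt0.
pose xi j : R := (j%:R + 2^-1) / N%:R.
have xiP j : (j.+1 < N)%N -> j%:R / N%:R < xi j < j.+1%:R / N%:R.
  by move=> _; rewrite /xi !ltr_pM2r// -(natr1 j); apply/andP; split; lra.
apply: le_trans (H xi xiP); apply: sumr_ge0 => j _.
rewrite divr_ge0 ?(ltW N0)// f0//.
have jN : (j.+1 < N)%N by have := ltn_ord j; rewrite /N; lia.
have /andP[x1 x2] := xiP j jN; apply/andP; split.
  by apply: le_trans (ltW x1); rewrite divr_ge0.
by apply: lt_trans x2 _; rewrite ltr_pdivrMr// mul1r ltr_nat.
Qed.

Lemma sum_succ n : \sum_(i < n) i.+1%:R = n%:R * n.+1%:R / 2 :> R.
Proof.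
elim: n => [|n IH]; first by rewrite big_ord0 !mul0r.
by rewrite big_ord_recr /= IH -!natr1; field.
Qed.

(** With [x j = j / N], the increment of [u] over the cell from [x j] to
    [x j.+1] is multiplied by [x j] in the summation by parts, and [x j] is less
    than the tag [xi j] given by the mean value theorem. Hence the mean
    distance is bounded by the Riemann sum of [x * `|du x|] at these tags, apart
    from the last cell, which is small by continuity at [1]. *)
Lemma half_estimate f u du (l q C : R) : 1 <= q -> 0 < C ->
  left_int f 0 1 l -> (forall x : R, 0 <= x < 1 -> 0 <= f x) ->
  (forall x : R, 0 < x < 1 -> is_derive x 1 u (du x)) ->
  (forall x : R, 0 < x < 1 -> x * (`|du x| / C) `^ q <= f x) ->
  (forall eta : R, 0 < eta -> exists2 rho : R, 0 < rho &
     forall x : R, 1 - rho < x < 1 -> `|u 1 - u x| < eta) ->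
  uniform_dist_le u (C / 2 * (2 * l) `^ q^-1).
Proof.
move=> q1 C0 fl f0 du_ du_le u1 eta eta0.
have q0 : 0 < q by lra.
have l0 := left_int_ge0 fl f0.
have [e e0 eP] : exists2 e : R, 0 < e &
    forall s, 0 <= s <= 2 * l + e -> s `^ q^-1 <= (2 * l) `^ q^-1 + eta / C.
  by apply: powR_right_cont; rewrite ?mulr_ge0 ?invr_gt0 ?divr_gt0.
have e20 : 0 < e / 2 by lra.
have [M1 M1P] := uniform_tags_le fl f0 e20.
have eta20 : 0 < eta / 2 by lra.
have [rho rho0 rhoP] := u1 _ eta20.
exists (maxn M1 (Num.truncn rho^-1)) => m N; rewrite geq_max => /andP[mM1 mM2] Nm.
have NE : N = (2 * m).+2 by rewrite Nm mulnS.
have NR : N%:R = 2 * (m%:R + 1) :> R by rewrite Nm natrM natr1.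
have m0 : 0 <= m%:R :> R by rewrite ler0n.
have N0 : 0 < N%:R :> R by rewrite Nm ltr0n.
have Ni0 : 0 < N%:R^-1 :> R by rewrite invr_gt0.
have dm : N%:R^-1 < rho.
  have m10 : 0 < m%:R + 1 :> R by lra.
  rewrite -[ltRHS]invrK ltf_pV2 ?posrE ?invr_gt0// NR.
  have : rho^-1 < m.+1%:R by apply: lt_le_trans (truncnS_gt _) _; rewrite ler_nat ltnS.
  by rewrite -natr1; lra.
pose x j : R := j%:R / N%:R.
have xS j : x j.+1 = x j + N%:R^-1 by rewrite /x -natr1 mulrDl mul1r.
have x_ge0 j : 0 <= x j by rewrite divr_ge0.
have x_gt0 j : (0 < j)%N -> 0 < x j by move=> j0; rewrite divr_gt0// ltr0n.
have xN : x N = 1 by rewrite /x divff// gt_eqF.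
have x_lt1 j : (j < N)%N -> x j < 1 by move=> jN; rewrite ltr_pdivrMr// mul1r ltr_nat.
have ex j : exists z, (x j < z < x j.+1) /\
    ((0 < j)%N -> (j.+1 < N)%N -> `|u (x j.+1) - u (x j)| = `|du z| / N%:R).
  have xj : x j < x j.+1 by rewrite xS; lra.
  (* The mean value theorem is only needed, and only available, in the inner
     cells; elsewhere any interior point will do. *)
  have [/andP[j0 jN]|jn] := boolP ((0 < j)%N && (j.+1 < N)%N); last first.
    exists (x j + N%:R^-1 / 2); split; first by rewrite xS; apply/andP; split; lra.
    by move=> j0 jN; rewrite j0 jN in jn.
  have inI z : x j <= z <= x j.+1 -> 0 < z < 1.
    move=> /andP[z1 z2]; rewrite (lt_le_trans (x_gt0 j j0) z1)/=.
    exact: le_lt_trans z2 (x_lt1 _ jN).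
  have duI z : z \in `]x j, x j.+1[ -> is_derive z 1 u (du z).
    by rewrite in_itv/= => /andP[z1 z2]; apply/du_/inI; rewrite !ltW.
  have cu : {within `[x j, x j.+1], continuous u}.
    apply: continuous_in_subspaceT => z; rewrite inE/= in_itv/= => zj.
    apply: differentiable_continuous; apply/derivable1_diffP.
    by have := du_ z (inI z zj); case.
  have [c cj ->] := MVT xj duI cu.
  exists c; split=> [|_ _]; first by move: cj; rewrite in_itv.
  have -> : x j.+1 - x j = N%:R^-1 by rewrite xS addrC addKr.
  by rewrite normrM (gtr0_norm Ni0).
have [xi xiP] := choice ex.
have xi_ge0 j : 0 <= xi j by have [/andP[/ltW xx _] _] := xiP j; exact: le_trans xx.
have xi01 j : (j.+1 < N)%N -> 0 < xi j < 1.
  move=> jN; have [/andP[x1 x2] _] := xiP j.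
  by rewrite (le_lt_trans (x_ge0 j) x1)/= (lt_trans x2)// x_lt1.
have T0 : 0 < 2 * l + e by lra.
pose w j := xi j / N%:R.
pose y j := `|du (xi j)| / C.
have w0 j : 0 <= w j by rewrite divr_ge0 ?(ltW N0).
have y0 j : 0 <= y j by rewrite divr_ge0 ?(ltW C0).
have N1 : N.-1 = (2 * m).+1 by rewrite NE.
have NS : N.-1.+1 = N by rewrite NE.
have sw : \sum_(j < N.-1) w j <= 1 / 2.
  apply: (@le_trans _ _ (\sum_(j < N.-1) j.+1%:R / N%:R / N%:R)).
    apply: ler_sum => j _; rewrite /w ler_wpM2r ?(ltW Ni0)//.
    by have [/andP[_ /ltW]] := xiP j.
  have NN : N.-1%:R = N%:R - 1 :> R by rewrite -[in RHS]NS -natr1 addrK.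
  rewrite -!mulr_suml sum_succ NS NN.
  have -> : (N%:R - 1) * N%:R / 2 / N%:R / N%:R = (1 - N%:R^-1) / 2 :> R.
    by field; rewrite gt_eqF.
  by rewrite ler_wpM2r// gerBl ltW.
have swy : \sum_(j < N.-1) w j * y j `^ q <= (2 * l + e) / 2.
  have -> : (2 * l + e) / 2 = l + e / 2 by field.
  apply: le_trans (M1P m N mM1 Nm xi _); last by move=> j _; case: (xiP j).
  apply: ler_sum => j _; rewrite mulrAC ler_wpM2r ?(ltW Ni0)//.
  by apply/du_le/xi01; rewrite -[X in (_ < X)%N]NS ltnS; exact: ltn_ord.
have := power_mean_le q1 T0 w0 y0 sw swy.
set P := \sum_(j < N.-1) w j * y j => PT.
have {}PT : P <= ((2 * l) `^ q^-1 + eta / C) / 2.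
  apply: le_trans PT _; rewrite ler_wpM2r ?invr_ge0// eP// lexx andbT ltW//.
have := sum_dist_last_le (fun j => u (x j.+1)) N.-1.
rewrite /= NS xN => /(ler_wpM2r (ltW Ni0)) /le_trans; apply.
rewrite N1 big_ord_recr /= mulrDl -NE xN.
have last_le : (2 * m).+1%:R * `|u 1 - u (x (2 * m).+1)| / N%:R <= eta / 2.
  rewrite mulrAC -[leRHS]mul1r; apply: ler_pM => //.
  - by rewrite ler_pdivrMr// mul1r ler_nat NE.
  - apply/ltW/rhoP; rewrite x_lt1 ?NE// andbT.
    by move: xN; rewrite {1}NE xS; lra.
have first_le : (\sum_(i < 2 * m) i.+1%:R * `|u (x i.+2) - u (x i.+1)|) / N%:R <= C * P.
  rewrite mulr_suml mulr_sumr N1 [leRHS]big_ord_recl /=.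
  apply: ler_wpDl; first exact: mulr_ge0 (ltW C0) (mulr_ge0 (w0 _) (y0 _)).
  apply: ler_sum => i _; rewrite /bump/= add1n.
  have iN : (i.+2 < N)%N by rewrite [X in (_ < X)%N]NE !ltnS; exact: ltn_ord.
  have [/andP[x1 _] ->//] := xiP i.+1.
  have dN : 0 <= `|du (xi i.+1)| / N%:R by rewrite divr_ge0 ?(ltW N0).
  have -> : C * (w i.+1 * y i.+1) = xi i.+1 * (`|du (xi i.+1)| / N%:R).
    by rewrite /w /y; field; rewrite !gt_eqF.
  by rewrite mulrAC; exact: ler_wpM2r (ltW x1).
have := lerD first_le last_le => /le_trans; apply.
have := ler_wpM2l (ltW C0) PT.
have -> : C * (((2 * l) `^ q^-1 + eta / C) / 2) = C / 2 * (2 * l) `^ q^-1 + eta / 2.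
  by field; rewrite gt_eqF.
by lra.
Qed.

End HalfEstimate.

(** * Left sums of continuous functions *)

Section ContinuousLeftIntegral.
Context {R : realType}.
Implicit Types (f F : R -> R) (a b : R).
Local Notation mu := (@lebesgue_measure R).

Lemma itv_unif_continuous f a b : {within `[a, b], continuous f} ->
  forall eps : R, 0 < eps -> exists2 d : R, 0 < d &
    forall x z : R, a <= x <= b -> a <= z <= b -> `|z - x| < d -> `|f z - f x| < eps.
Proof.
move=> cf eps e0.
have /compact_near_coveringP/near_covering_withinP := @segment_compact R a b.
pose P (d x : R) := forall z, a <= z <= b -> `|z - x| < d -> `|f z - f x| < eps.
move=> /(_ R 0^'+ P _) [].
  move=> x; rewrite /= in_itv/= => xab.
  have e20 : 0 < eps / 2 by lra.
  move/subspace_continuousP : cf => /(_ x); rewrite /= in_itv/= => /(_ xab).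
  move=> /cvgrPdist_lt /(_ _ e20) [r /= r0 rP].
  have r20 : 0 < r / 2 by lra.
  exists ([set y : R | `|x - y| < r / 2], [set d : R | 0 < d < r / 2]).
    split => /=; first by exists (r / 2).
    exists (r / 2) => // d /=; rewrite sub0r normrN => dr d0; rewrite d0/=.
    by rewrite -[ltLHS]gtr0_norm.
  move=> [y d] /= [xy /andP[d0 dr]]; rewrite in_itv/= => yab z zab zy.
  have h1 : `|f x - f y| < eps / 2.
    by apply: rP; [rewrite /=; lra|rewrite in_itv].
  have h2 : `|f x - f z| < eps / 2.
    apply: rP; last by rewrite in_itv.
    by have := ler_distD y x z; rewrite /= (distrC y z); lra.
  by have := ler_distD (f x) (f z) (f y); rewrite (distrC (f z) (f x)); lra.
move=> d /= d0; rewrite /P => dP.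
exists (d / 2); first by lra.
move=> x z xab; apply: (dP (d / 2)); rewrite ?in_itv//=; last by lra.
by rewrite sub0r normrN gtr0_norm; lra.
Qed.

Lemma continuous_primitive f a b : a < b -> {within `[a, b], continuous f} ->
  exists2 F, {within `[a, b], continuous F} &
    forall x : R, a < x < b -> is_derive x 1 F (f x).
Proof.
move=> ab cf.
have fi : mu.-integrable `[a, b] (EFin \o f).
  by apply: continuous_compact_integrable => //; exact: segment_compact.
exists (fun x => \int[mu]_(t in `[a, x]) f t).
  exact: parameterized_integral_continuous (ltW ab) fi.
move=> x /andP[ax xb].
have cfx : {for x, continuous f}.
  by move/(continuous_within_itvP _ ab) : cf => [+ _ _]; apply; rewrite in_itv/= ax.
have [dF FE] := @continuous_FTC1_closed R f a x b xb fi ax cfx.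
by apply: DeriveDef; [exact: dF|rewrite -derive1E; exact: FE].
Qed.

(** Each cell contributes, by the mean value theorem, [f c * (y - x)] to the
    increment of a primitive, and uniform continuity compares [f c] with the
    value at the left end point. *)
Lemma continuous_left_int f a b : a < b -> {within `[a, b], continuous f} ->
  exists l, left_int f a b l.
Proof.
move=> ab cf; have [F cF dF] := continuous_primitive ab cf.
exists (F b - F a) => eps e0.
have e20 : 0 < eps / (2 * (b - a)) by rewrite divr_gt0// mulr_gt0// subr_gt0.
have [d d0 dP] := itv_unif_continuous cf e20.
exists d => // s p lst.
suff H : forall s x, a <= x <= b -> path (fine_step d) x s -> last x s = b ->
    `|lsum f x s - (F b - F x)| <= eps / (2 * (b - a)) * (b - x).
  have aab : a <= a <= b by rewrite lexx ltW.
  apply: le_lt_trans (H s a aab p lst) _.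
  rewrite [ltLHS](_ : _ = eps / 2); first by lra.
  by field; rewrite subr_eq0 gt_eqF.
move=> {p lst} {}s; elim: s => [|y s IH] x xab /=.
  by move=> _ ->; rewrite subrr subr0 normr0 subrr mulr0.
move=> /andP[/andP[xy yxd] p] lst.
have yb : y <= b.
  elim: s y {IH xy yxd} p lst => [|z s IH] y /=; first by move=> _ ->.
  by move=> /andP[/andP[yz _] p] /(IH _ p); apply: le_trans; exact: ltW.
have /andP[ax xb] := xab.
have yab : a <= y <= b by rewrite yb andbT (le_trans ax)// ltW.
have dFI z : z \in `]x, y[ -> is_derive z 1 F (f z).
  rewrite in_itv/= => /andP[z1 z2]; apply: dF.
  by rewrite (le_lt_trans ax z1) (lt_le_trans z2 yb).
have cFI : {within `[x, y], continuous F}.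
  by apply: continuous_subspaceW cF; apply: subset_itv; rewrite bnd_simp.
have [c] := MVT xy dFI cFI; rewrite in_itv/= => /andP[c1 c2] FE.
have cab : a <= c <= b by rewrite (le_trans ax (ltW c1))/= (le_trans (ltW c2)).
have fc : `|f x - f c| <= eps / (2 * (b - a)).
  apply/ltW/dP => //; rewrite distrC gtr0_norm; lra.
have -> : f x * (y - x) + lsum f y s - (F b - F x) =
    (f x - f c) * (y - x) + (lsum f y s - (F b - F y)).
  rewrite mulrBl -FE; ring.
apply: le_trans (ler_normD _ _) _.
have -> : eps / (2 * (b - a)) * (b - x) =
    eps / (2 * (b - a)) * (y - x) + eps / (2 * (b - a)) * (b - y) by ring.
apply: lerD; last exact: IH.
by rewrite normrM (gtr0_norm (_ : 0 < y - x)) ?subr_gt0// ler_wpM2r ?subr_ge0// ltW.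
Qed.

End ContinuousLeftIntegral.

(** * Pairing symmetric points *)

Section TrapezoidEstimate.
Context {R : realType}.
Implicit Types (W G : R -> R) (nu mu : R).

Lemma ler_addeps (k x y : R) : 0 <= k -> (forall e, 0 < e -> x <= y + e * k) -> x <= y.
Proof.
move=> k0 H; apply/ler_addgt0Pr => e e0.
have k1 : 0 < k + 1 by lra.
apply: le_trans (H (e / (k + 1)) (divr_gt0 e0 k1)) _.
by rewrite lerD2l mulrAC ler_pdivrMr// ler_pM2l// lerDl.
Qed.

Lemma sum_fold_middle (t : nat -> R) n :
  \sum_(j < 2 * n.+1) t j =
  t 0%N + t n.+1 + \sum_(i < n) (t (n.+1 - i.+1)%N + t (n.+1 + i.+1)%N).
Proof.
rewrite mul2n -addnn big_split_ord /= big_split/=.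
have -> : \sum_(i < n.+1) t (lshift n.+1 i) = t 0%N + \sum_(i < n) t (n.+1 - i.+1)%N.
  rewrite (reindex_inj rev_ord_inj) big_ord_recr /= subnn addrC.
  by congr (_ + _).
rewrite big_ord_recl /= addn0.
have -> : \sum_(i < n) t (n.+1 + bump 0 i)%N = \sum_(i < n) t (n.+1 + i.+1)%N by [].
ring.
Qed.

Lemma conv_mid_itv nu mu (c g : R) : nu < mu -> nu <= c <= mu -> 0 <= g < 1 ->
  nu < g * c + (1 - g) * ((nu + mu) / 2) < mu.
Proof.
move=> numu /andP[nuc cmu] /andP[g0 g1].
have h1 : 0 <= g * (c - nu) by rewrite mulr_ge0// subr_ge0.
have h2 : 0 <= g * (mu - c) by rewrite mulr_ge0// subr_ge0.
have h3 : 0 < (1 - g) * (mu - nu) by rewrite mulr_gt0// subr_gt0.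
by apply/andP; split; lra.
Qed.

(** With [2 * N] cells, the points [x (N - k)] and [x (N + k)] are symmetric, and
    their terms add up to [W] times the distances of [u1] and [u2] at [k / N] to
    their end values. The two terms without partner, at [nu] and at the
    midpoint, vanish in the limit. *)
Lemma trapezoid_estimate W G nu mu (S IW IWG B1 B2 : R) : nu < mu ->
  (forall x, nu <= x <= mu -> 0 <= W x <= S) ->
  (forall x, nu <= x <= mu -> W (nu + mu - x) = W x) ->
  left_int W nu mu IW -> left_int (fun x => W x * G x) nu mu IWG ->
  uniform_dist_le (fun t => G (t * nu + (1 - t) * ((nu + mu) / 2))) B1 ->
  uniform_dist_le (fun t => G (t * mu + (1 - t) * ((nu + mu) / 2))) B2 ->
  `|(G nu + G mu) / 2 * IW - IWG| <= S * (mu - nu) / 2 * (B1 + B2).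
Proof.
move=> numu WS Wsym hW hWG hB1 hB2.
set c := (G nu + G mu) / 2.
pose mid := (nu + mu) / 2.
have nn : nu <= nu <= mu by rewrite lexx ltW.
have S0 : 0 <= S by have /andP[w0 /(le_trans w0)] := WS nu nn.
pose K := `|W nu * (c - G nu)| + `|W mid * (c - G mid)|.
have K0 : 0 <= K by rewrite addr_ge0.
apply: (@ler_addeps (`|c| + 1 + (mu - nu) * K + S * (mu - nu))).
  by rewrite !addr_ge0 ?mulr_ge0// subr_ge0 ltW.
move=> e e0.
have [d1 d10 d1P] := left_int_grid hW e0.
have [d2 d20 d2P] := left_int_grid hWG e0.
have [M1 M1P] := hB1 _ e0.
have [M2 M2P] := hB2 _ e0.
have [d d0 [dd1 dd2 dd3]] : exists2 d : R, 0 < d & [/\ d <= d1, d <= d2 & d <= e * (mu - nu)].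
  exists (Num.min (Num.min d1 d2) (e * (mu - nu))).
    by rewrite !lt_min d10 d20 mulr_gt0// subr_gt0.
  by split; rewrite !ge_min lexx ?orbT.
have [m [mM1 mM2 mM3]] : exists m, [/\ (M1 <= m)%N, (M2 <= m)%N &
    (Num.truncn ((mu - nu) / d) <= m)%N].
  exists (maxn (maxn M1 M2) (Num.truncn ((mu - nu) / d))).
  by rewrite !leq_max !leqnn !orbT.
have [N Nm] : exists N, N = (2 * m.+1)%N by exists (2 * m.+1)%N.
have N0 : 0 < N%:R :> R by rewrite Nm ltr0n.
have NS : N.-1.+1 = N by rewrite Nm mulnS.
pose h := (mu - nu) / 2 / N%:R.
have h0 : 0 < h by rewrite !divr_gt0// subr_gt0.
have hd : h < d.
  have : (mu - nu) / d < m.+1%:R by apply: lt_le_trans (truncnS_gt _) _; rewrite ler_nat.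
  rewrite ltr_pdivrMr// mulrC => mund; rewrite /h -mulrA -invfM ltr_pdivrMr ?mulr_gt0//.
  apply: lt_le_trans mund _; rewrite ler_pM2l// Nm natrM.
  by have : 0 <= m.+1%:R :> R by []; lra.
pose x j : R := nu + j%:R * h.
have xE : nu + (2 * N)%:R * h = mu by rewrite /h natrM; field; rewrite gt_eqF.
have := d1P (2 * N)%N h h0 (lt_le_trans hd dd1) xE.
have := d2P (2 * N)%N h h0 (lt_le_trans hd dd2) xE.
set sWG := \sum_(i < _) _; set sW := \sum_(i < _) _ => leWG leW.
pose t j := W (x j) * (c - G (x j)).
have tE : c * sW - sWG = (\sum_(j < 2 * N) t j) * h.
  rewrite /sW /sWG mulr_sumr -sumrB mulr_suml; apply: eq_bigr => i _.
  by rewrite /t /x; ring.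
pose u1 g := G (g * nu + (1 - g) * mid).
pose u2 g := G (g * mu + (1 - g) * mid).
have pair k : (0 < k < N)%N -> `|t (N - k)%N + t (N + k)%N| <=
    S * (`|u1 (k%:R / N%:R) - G nu| + `|u2 (k%:R / N%:R) - G mu|).
  move=> /andP[k0 kN].
  have g01 : 0 <= (k%:R / N%:R : R) < 1.
    by rewrite divr_ge0//= ltr_pdivrMr// mul1r ltr_nat.
  have xm : x (N - k)%N = k%:R / N%:R * nu + (1 - k%:R / N%:R) * mid.
    rewrite /x /h natrB ?(ltnW kN)// /mid; field; exact: lt0r_neq0.
  have xp : x (N + k)%N = k%:R / N%:R * mu + (1 - k%:R / N%:R) * mid.
    rewrite /x /h natrD /mid; field; exact: lt0r_neq0.
  have xpm : x (N + k)%N = nu + mu - x (N - k)%N.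
    by rewrite xp xm /mid; field; exact: lt0r_neq0.
  have xin : nu <= x (N - k)%N <= mu.
    by have /andP[? ?] := conv_mid_itv numu nn g01; rewrite xm !ltW.
  rewrite /u1 /u2 -xm -xp /t [in W (x (N + k)%N)]xpm Wsym// -mulrDr.
  have /andP[W0 WS1] := WS _ xin.
  rewrite normrM (ger0_norm W0); apply: ler_pM => //.
  have -> : c - G (x (N - k)%N) + (c - G (x (N + k)%N)) =
      (G nu - G (x (N - k)%N)) + (G mu - G (x (N + k)%N)) by rewrite /c; field.
  by rewrite ![`|G (x _) - _|]distrC; exact: ler_normD.
have := M1P m N mM1 Nm; have := M2P m N mM2 Nm.
rewrite !mul1r !subrr !mul0r !addr0 -/mid.
set s2 := \sum_(j < _) _; set s1 := \sum_(j < _) _ => le2 le1.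
have fold_le : `|\sum_(i < N.-1) (t (N - i.+1)%N + t (N + i.+1)%N)| <= S * (s1 + s2).
  apply: le_trans (ler_norm_sum _ _ _) _; rewrite -big_split/= mulr_sumr.
  by apply: ler_sum => i _; apply: pair; rewrite /= -[X in (_ < X)%N]NS ltnS ltn_ord.
have ends : `|t 0%N| + `|t N| = K.
  have x0 : x 0%N = nu by rewrite /x mul0r addr0.
  have xN : x N = mid by rewrite /x /h /mid; field; exact: lt0r_neq0.
  by rewrite /t x0 xN.
have sum_le : `|\sum_(j < 2 * N) t j| <= K + S * (s1 + s2).
  have := sum_fold_middle t N.-1; rewrite NS => ->.
  apply: le_trans (ler_normD _ _) _; apply: lerD => //.
  by rewrite -ends ler_normD.
have -> : c * IW - IWG = (c * sW - sWG) + (c * (IW - sW) + (sWG - IWG)) by ring.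
apply: le_trans (ler_normD _ _) _.
have rest : `|c * (IW - sW) + (sWG - IWG)| <= `|c| * e + e.
  apply: le_trans (ler_normD _ _) _; rewrite normrM.
  by apply: lerD (ltW leWG); rewrite ler_wpM2l// distrC ltW.
have hK : h * K <= e * (mu - nu) * K by rewrite ler_wpM2r// ltW// (lt_le_trans hd).
have hs : h * (S * (s1 + s2)) <= S * (mu - nu) / 2 * (B1 + e + (B2 + e)).
  have -> : h * (S * (s1 + s2)) = S * (mu - nu) / 2 * (s1 / N%:R + s2 / N%:R).
    by rewrite /h; field; exact: lt0r_neq0.
  by rewrite ler_wpM2l ?lerD// divr_ge0// mulr_ge0// subr_ge0 ltW.
rewrite tE normrM (gtr0_norm h0) mulrC.
have := ler_wpM2l (ltW h0) sum_le; rewrite mulrDr.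
by lra.
Qed.

End TrapezoidEstimate.

(** * From local fractional calculus to ordinary calculus *)

Section FractalToReal.
Context {R : realType}.
Implicit Types (f G W : R -> R) (I : set R) (a b x alpha : R).

Lemma lf_intP alpha f a b : lf_integrable (f : R -> fractal alpha) a b ->
  left_int f a b (lf_int (f : R -> fractal alpha) a b).
Proof. by move=> [l lP]; apply/(@is_lf_intP R alpha)/(xgetPex _ (ex_intro _ l lP)). Qed.

Lemma lsum_lincomb f1 f2 c1 c2 a s :
  lsum (fun x => c1 * f1 x + c2 * f2 x) a s = c1 * lsum f1 a s + c2 * lsum f2 a s.
Proof. by elim: s a => [|y s IH] a /=; rewrite ?mulr0 ?addr0// IH; ring. Qed.

Lemma fine_step_le (d d' : R) a s : d <= d' -> path (fine_step d) a s -> path (fine_step d') a s.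
Proof.
move=> dd; apply: sub_path => x y /andP[xy yx].
by rewrite /fine_step/= xy (lt_le_trans yx dd).
Qed.

Lemma left_int_lincomb f1 f2 a b (l1 l2 c1 c2 : R) :
  left_int f1 a b l1 -> left_int f2 a b l2 ->
  left_int (fun x => c1 * f1 x + c2 * f2 x) a b (c1 * l1 + c2 * l2).
Proof.
move=> h1 h2 eps e0.
have k0 : 0 < `|c1| + `|c2| + 1 by rewrite ltr_wpDl// addr_ge0.
have e1 : 0 < eps / (`|c1| + `|c2| + 1) by rewrite divr_gt0.
have [d1 d10 d1P] := h1 _ e1; have [d2 d20 d2P] := h2 _ e1.
exists (Num.min d1 d2); first by rewrite lt_min d10.
move=> s p lst.
have [dd1 dd2] : Num.min d1 d2 <= d1 /\ Num.min d1 d2 <= d2.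
  by split; rewrite ge_min lexx ?orbT.
have le1 := d1P s (fine_step_le dd1 p) lst.
have le2 := d2P s (fine_step_le dd2 p) lst.
have -> : eps = (`|c1| + `|c2| + 1) * (eps / (`|c1| + `|c2| + 1)).
  by field; rewrite gt_eqF.
move: (eps / _) e1 le1 le2 => e e_gt0 le1 le2.
rewrite lsum_lincomb.
have -> : c1 * lsum f1 a s + c2 * lsum f2 a s - (c1 * l1 + c2 * l2) =
  c1 * (lsum f1 a s - l1) + c2 * (lsum f2 a s - l2) by ring.
apply: le_lt_trans (ler_normD _ _) _; rewrite !normrM.
have := ler_wpM2l (normr_ge0 c1) (ltW le1); have := ler_wpM2l (normr_ge0 c2) (ltW le2).
by lra.
Qed.

Lemma lf_derivable_approx alpha I G x :
  lf_derivable I (G : R -> fractal alpha) x ->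
  forall eps : R, 0 < eps -> exists2 rho : R, 0 < rho &
    forall y, I y -> y != x -> `|y - x| < rho ->
      `|fscal alpha (Gamma (alpha + 1)) * (G y - G x) / (y - x)
        - (lf_derive I (G : R -> fractal alpha) x : R)| < eps.
Proof.
move=> [_ cG] eps e0.
move/cvgrPdist_lt : cG => /(_ eps e0).
rewrite near_withinE => -[rho /= rho0 rhoP].
exists rho => // y Iy yx xy; rewrite distrC (addrC alpha).
by apply: rhoP => //=; rewrite distrC.
Qed.

(** The difference quotients of [G] are only known at points of [[nu, mu]], which
    is a neighbourhood of [x]. *)
Lemma approx_is_derive G x (nu mu k D : R) : 0 < k -> nu < x < mu ->
  (forall eps : R, 0 < eps -> exists2 rho : R, 0 < rho &
    forall y, nu <= y <= mu -> y != x -> `|y - x| < rho ->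
      `|k * (G y - G x) / (y - x) - D| < eps) ->
  is_derive x 1 G (D / k).
Proof.
move=> k0 /andP[nux xmu] H.
suff cvgD : h^-1 *: ((G \o shift x) (h *: 1) - G x) @[h --> 0^'] --> D / k.
  by apply: DeriveDef; [apply/cvg_ex; exists (D / k)|exact: cvg_lim cvgD].
apply/cvgrPdist_lt => eps e0.
have ke0 : 0 < k * eps by rewrite mulr_gt0.
have [rho rho0 rhoP] := H _ ke0.
pose r := Num.min rho (Num.min (x - nu) (mu - x)).
exists r => /=; first by rewrite !lt_min rho0 !subr_gt0 nux xmu.
move=> h; rewrite /= sub0r normrN !lt_min => /and3P[hr h1 h2] hn0.
have hle : nu <= h + x <= mu.
  by move: h1 h2; rewrite !ltr_norml => /andP[? ?] /andP[? ?]; apply/andP; split; lra.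
have hx : h + x != x by rewrite -subr_eq0 addrK.
have hxx : `|h + x - x| < rho by rewrite addrK.
have := rhoP _ hle hx hxx; rewrite addrK distrC /GRing.scale/= mulr1.
have -> : D / k - h^-1 * (G (h + x) - G x) = (D - k * (G (h + x) - G x) / h) / k.
  by field; rewrite hn0 gt_eqF.
by rewrite normrM normfV (gtr0_norm k0) ltr_pdivrMr// [eps * k]mulrC.
Qed.

Lemma approx_continuous_at G x (nu mu k D : R) : 0 < k ->
  (forall eps : R, 0 < eps -> exists2 rho : R, 0 < rho &
    forall y, nu <= y <= mu -> y != x -> `|y - x| < rho ->
      `|k * (G y - G x) / (y - x) - D| < eps) ->
  forall eps : R, 0 < eps -> exists2 rho : R, 0 < rho &
    forall y, nu <= y <= mu -> `|y - x| < rho -> `|G y - G x| < eps.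
Proof.
move=> k0 H eps e0; have [rho rho0 rhoP] := H 1 ltr01.
have K0 : 0 < (`|D| + 1) / k by rewrite divr_gt0// ltr_wpDl.
exists (Num.min rho (eps / ((`|D| + 1) / k))); first by rewrite lt_min rho0 divr_gt0.
move=> y yin; rewrite lt_min => /andP[yr].
have [->|yx] := eqVneq y x; first by rewrite !subrr normr0.
have := rhoP y yin yx yr; set Q := _ / (y - x) => QD.
have GE : G y - G x = Q / k * (y - x).
  by rewrite /Q; field; rewrite subr_eq0 yx gt_eqF.
rewrite ltr_pdivlMr// mulrC => /(le_lt_trans _); apply.
rewrite GE normrM ler_wpM2r// normrM normfV (gtr0_norm k0) ler_wpM2r ?invr_ge0 ?(ltW k0)//.
by rewrite -[Q](subrK D) addrC (le_trans (ler_normD _ _))// lerD2l ltW.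
Qed.

Lemma itv_continuous_of_approx f a b :
  (forall x, a <= x <= b -> forall eps : R, 0 < eps -> exists2 rho : R, 0 < rho &
    forall y, a <= y <= b -> `|y - x| < rho -> `|f y - f x| < eps) ->
  {within `[a, b], continuous f}.
Proof.
move=> cf; apply/subspace_continuousP => x; rewrite /= in_itv/= => xab.
apply/cvgrPdist_lt => eps e0.
have [rho rho0 rhoP] := cf x xab eps e0.
rewrite near_withinE; exists rho => //= y xy; rewrite in_itv/= => yab.
by rewrite distrC; apply: rhoP => //; rewrite distrC.
Qed.

(** The bound on [`|D (g * c + (1 - g) * mid)| `^ q] is what (h-m)-convexity says
    about the points [c] and [mid / m]. Left sums integrate it after
    multiplication by [g], although they need not integrate [h], which may be
    unbounded near [0]. *)
Lemma half_bound G D h (nu mu c k q m a b L1 L2 : R) : nu < mu ->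
  nu <= c <= mu -> `|c - (nu + mu) / 2| = (mu - nu) / 2 -> 0 < k -> 1 <= q ->
  0 <= m -> 0 <= a -> 0 <= b ->
  (forall x, nu < x < mu -> is_derive x 1 G (D x / k)) ->
  (forall eps : R, 0 < eps -> exists2 rho : R, 0 < rho &
    forall y, nu <= y <= mu -> `|y - c| < rho -> `|G y - G c| < eps) ->
  (forall g, 0 < g < 1 -> 0 <= h g) ->
  (forall g, 0 < g < 1 ->
    `|D (g * c + (1 - g) * ((nu + mu) / 2))| `^ q <= h g * a + m * h (1 - g) * b) ->
  left_int (fun g => g * h g) 0 1 L1 ->
  left_int (fun g => g * m * h (1 - g)) 0 1 L2 ->
  let L := a * L1 + b * L2 in
  0 <= L /\ uniform_dist_le (fun t => G (t * c + (1 - t) * ((nu + mu) / 2)))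
     ((mu - nu) / (2 * k) / 2 * (2 * L) `^ q^-1).
Proof.
move=> numu cin cmid k0 q1 m0 a0 b0 dG cG h0 conv i1 i2 L.
set mid := (nu + mu) / 2 in cmid conv *.
have fL := left_int_lincomb a b i1 i2.
have f0 g : 0 <= g < 1 -> 0 <= a * (g * h g) + b * (g * m * h (1 - g)).
  move=> /andP[g0 g1]; have [->|gn0] := eqVneq g 0; first by rewrite !mul0r !mulr0 addr0.
  have gp : 0 < g < 1 by rewrite lt_neqAle eq_sym gn0 g0.
  have gp' : 0 < 1 - g < 1 by lra.
  by rewrite addr_ge0 ?mulr_ge0// ?h0.
split; first exact: left_int_ge0 fL f0.
have C0 : 0 < (mu - nu) / (2 * k) by rewrite divr_gt0 ?subr_gt0// mulr_gt0.
pose pt (g : R) := g * c + (1 - g) * mid.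
apply: (half_estimate (du := fun g => D (pt g) / k * (c - mid)) q1 C0 fL f0).
- move=> g /andP[g0 g1].
  have ptin : nu < pt g < mu by apply: conv_mid_itv => //; rewrite ltW.
  have dpt : is_derive g 1 pt (c - mid).
    by apply: is_derive_eq; rewrite /GRing.scale/=; ring.
  have dGp := dG _ ptin.
  have := @is_derive1_comp R G pt g _ _ dGp dpt.
  exact.
- move=> g g01; have /andP[g0 g1] := g01.
  have -> : `|D (pt g) / k * (c - mid)| / ((mu - nu) / (2 * k)) = `|D (pt g)|.
    rewrite !normrM cmid normfV (gtr0_norm k0); field.
    by rewrite !gt_eqF// subr_gt0.
  have := ler_wpM2l (ltW g0) (conv g g01) => /le_trans; apply.
  by rewrite le_eqVlt; apply/orP; left; apply/eqP; ring.
- move=> eta eta0; have [rho rho0 rhoP] := cG _ eta0.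
  have r0 : 0 < rho / (mu - nu) by rewrite divr_gt0// subr_gt0.
  exists (Num.min 1 (rho / (mu - nu))); first by rewrite lt_min ltr01.
  move=> g /andP[g0 g1].
  have /andP[gr1 gr2] : (1 - g < 1) && (1 - g < rho / (mu - nu)).
    by rewrite -lt_min; lra.
  have g01 : 0 <= g < 1 by lra.
  rewrite mul1r subrr mul0r addr0 distrC; apply: rhoP.
    by have /andP[? ?] := conv_mid_itv numu cin g01; rewrite !ltW.
  have -> : g * c + (1 - g) * mid - c = (g - 1) * (c - mid) by ring.
  rewrite normrM cmid distrC gtr0_norm ?subr_gt0//.
  move: gr2; rewrite ltr_pdivlMr ?subr_gt0//; apply: le_lt_trans.
  have : 0 <= (1 - g) * (mu - nu) by rewrite mulr_ge0 ?subr_ge0 ?ltW.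
  by lra.
Qed.

(** The factors [2] and [k] collected by the estimates on the two halves amount
    to [(2 * k) `^ q^-1 / (2 * k) = (2 * k)^-1 `^ (1 - q^-1)]. *)
Lemma trapezoid_algebra (k q c IW IWG S L1 L2 A1 A2 d Q : R) :
  0 < k -> 1 <= q -> 0 <= S -> 0 < d -> 0 <= L1 -> 0 <= L2 ->
  L1 / k = A1 -> L2 / k = A2 ->
  (2 * k)^-1 `^ (1 - q^-1) <= Q ->
  `|c * IW - IWG| <=
    S * d / 2 * (d / (2 * k) / 2 * (2 * L1) `^ q^-1 + d / (2 * k) / 2 * (2 * L2) `^ q^-1) ->
  `|c * (IW / k) - IWG / k| <=
    d ^+ 2 / 4 * (S / k) * Q * (A2 `^ q^-1 + A1 `^ q^-1).
Proof.
move=> k0 q1 S0 d0 L10 L20 <- <- Qle le.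
have q0 : 0 < q by lra.
have -> : c * (IW / k) - IWG / k = (c * IW - IWG) / k by ring.
rewrite normrM normfV (gtr0_norm k0) ler_pdivrMr//.
apply: le_trans le _.
have powE L : 0 <= L -> (2 * L) `^ q^-1 = (2 * k) `^ q^-1 * (L / k) `^ q^-1.
  move=> L0; rewrite -powRM ?divr_ge0 ?mulr_ge0// ?(ltW k0)//; congr (_ `^ _).
  by field; rewrite gt_eqF.
rewrite (powE _ L10) (powE _ L20).
set x1 := (L1 / k) `^ q^-1; set x2 := (L2 / k) `^ q^-1; set p := (2 * k) `^ q^-1.
have k20 : 0 < 2 * k by rewrite mulr_gt0.
have QE : (2 * k)^-1 `^ (1 - q^-1) = p / (2 * k).
  rewrite -(powR_inv1 (ltW k20)) -powRrM mulN1r opprB powRD ?powRN ?powRr1 ?ltW//.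
  by rewrite (gt_eqF k20) implybT.
rewrite QE in Qle.
have x10 : 0 <= x1 by exact: powR_ge0.
have x20 : 0 <= x2 by exact: powR_ge0.
have -> : S * d / 2 * (d / (2 * k) / 2 * (p * x1) + d / (2 * k) / 2 * (p * x2)) =
   d ^+ 2 / 4 * S * (x2 + x1) * (p / (2 * k)) by field; rewrite gt_eqF.
have -> : d ^+ 2 / 4 * (S / k) * Q * (x2 + x1) * k = d ^+ 2 / 4 * S * (x2 + x1) * Q.
  by field; rewrite gt_eqF.
apply: ler_wpM2l => //; apply: mulr_ge0; last exact: addr_ge0.
by apply: mulr_ge0 => //; apply: divr_ge0 => //; exact: sqr_ge0.
Qed.

End FractalToReal.

(** * The theorem *)

Section Constants.
Context {R : realType}.

(** This is [Gamma_double_le] raised to the power [r / alpha]. *)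
Lemma Gamma_constant_le (alpha r : R) : 0 < alpha <= 1 -> 0 <= r ->
  (2 * (@fscal R alpha (Gamma (alpha + 1)) : R))^-1 `^ r <=
  (@fscal R alpha ((Gamma (alpha + 1) / Gamma (2 * alpha + 1)) `^ r) : R).
Proof.
move=> a01 r0; have /andP[a0 a1] := a01.
have g1 : 1 <= alpha + 1 by lra.
have g2 : 1 <= 2 * alpha + 1 by lra.
have := Gamma_double_le a01.
rewrite /fscal /fpow.
move: (Gamma (alpha + 1)) (Gamma_gt0 g1) (Gamma (2 * alpha + 1)) (Gamma_gt0 g2).
move=> x x0 y y0 yx.
rewrite [leRHS]powRAC.
have xa0 : 0 < x `^ alpha^-1 by rewrite powR_gt0.
apply: ge0_ler_powR; rewrite ?nnegrE ?powR_ge0 ?invr_ge0 ?mulr_ge0 ?(ltW xa0)//.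
have t0 : 0 < 2 `^ alpha * x by rewrite mulr_gt0// powR_gt0.
have -> : (2 * x `^ alpha^-1)^-1 = ((2 `^ alpha * x)^-1) `^ alpha^-1.
  rewrite -(powR_inv1 (ltW t0)) -powRrM mulN1r powRN powRM ?powR_ge0 ?(ltW x0)//.
  by rewrite -powRrM mulfV ?powRr1// gt_eqF.
apply: ge0_ler_powR; rewrite ?nnegrE ?invr_ge0 ?(ltW a0) ?(ltW t0)//.
  exact: divr_ge0 (ltW x0) (ltW y0).
rewrite -[leRHS]invf_div lef_pV2 ?posrE ?divr_gt0// ler_pdivrMr//.
by rewrite -mulrA -expr2.
Qed.

End Constants.

Theorem theorem10 (R : realType) (alpha m q nu mu : R) (I D J : set R)
    (h G W : R -> fractal alpha)
    (halpha : 0 < alpha <= 1) (hm : 0 < m <= 1) (hq : 1 <= q)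
    (hJ : `]0, 1[ `<=` J) (h_ge0 : forall t, J t -> 0 <= h t)
    (hnumu : nu < mu) (hI : `[nu, mu] `<=` I)
    (G_cont : forall x, I° x -> lf_continuous_at I G x)
    (G_deriv : forall x, I° x -> lf_derivable I G x)
    (W_ge0 : forall x, x \in `[nu, mu] -> 0 <= W x)
    (W_sym : forall x, x \in `[nu, mu] -> W (nu + mu - x) = W x)
    (W_cont : forall x, x \in `[nu, mu] -> lf_continuous_at `[nu, mu] W x)
    (* D is the domain on which the convexity inequality is understood *)
    (DI : D `<=` I) (D_numu : `[nu, mu] `<=` D) (D_mid : D ((nu + mu) / (2 * m)))
    (G_derivD : forall x, D x -> lf_derivable I G x)
    (G_convex : hm_convex D h m (fun x => fexp `|lf_derive I G x| q))
    (h_int : lf_integrable (fun g => fpow alpha g * h g) 0 1)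
    (h_int' : lf_integrable (fun g => fpow alpha g * fpow alpha m * h (1 - g)) 0 1) :
  let G' := lf_derive I G in
  let A c :=
    fexp `|G' c| q / fscal alpha (Gamma (alpha + 1))
      * lf_int (fun g => fpow alpha g * h g) 0 1
    + fexp `|G' ((nu + mu) / (2 * m))| q / fscal alpha (Gamma (alpha + 1))
      * lf_int (fun g => fpow alpha g * fpow alpha m * h (1 - g)) 0 1 in
  `| (G nu + G mu) / fpow alpha 2 * lf_I W nu mu
     - lf_I (fun x => W x * G x) nu mu |
  <= fpow alpha ((mu - nu) ^+ 2 / 4)
     * (supnorm W nu mu / fscal alpha (Gamma (alpha + 1)))
     * fscal alpha ((Gamma (alpha + 1) / Gamma (2 * alpha + 1)) `^ (1 - q^-1))
     * (fexp (A mu) q^-1 + fexp (A nu) q^-1).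
Proof.
cbv zeta; have /andP[alpha0 alpha1] := halpha; have /andP[m0 m1] := hm.
have g1 : 1 <= alpha + 1 by rewrite lerDr ltW.
pose k : R := @fscal R alpha (Gamma (alpha + 1)).
have k0 : 0 < k by rewrite /k /fscal /fpow powR_gt0// Gamma_gt0.
pose D0 x : R := lf_derive I G x.
pose mid : R := (nu + mu) / 2.
have approx x : D x -> forall eps : R, 0 < eps -> exists2 rho : R, 0 < rho &
    forall y, nu <= y <= mu -> y != x -> `|y - x| < rho ->
      `|k * ((G y : R) - (G x : R)) / (y - x) - D0 x| < eps.
  move=> Dx eps eps0.
  have [rho rho0 rhoP] := lf_derivable_approx (G_derivD _ Dx) eps0.
  by exists rho => // y yin; apply: rhoP; apply: hI; rewrite /= in_itv.
have Dnm x : nu <= x <= mu -> D x by move=> xin; apply: D_numu; rewrite /= in_itv.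
have Gcont x : nu <= x <= mu -> forall eps : R, 0 < eps -> exists2 rho : R, 0 < rho &
    forall y, nu <= y <= mu -> `|y - x| < rho -> `|(G y : R) - (G x : R)| < eps.
  by move=> /Dnm/approx; exact: approx_continuous_at k0.
have Gder (x : R) : nu < x < mu -> is_derive x 1 (G : R -> R) (D0 x / k).
  move=> xin; apply: (approx_is_derive k0 xin); apply/approx/Dnm.
  by have /andP[? ?] := xin; rewrite !ltW.
have cG : {within `[nu, mu], continuous (G : R -> R)} by exact: itv_continuous_of_approx.
have cW : {within `[nu, mu], continuous (W : R -> R)}.
  apply: itv_continuous_of_approx => x xin eps eps0.
  have xin' : x \in `[nu, mu] by rewrite in_itv.
  have [rho rho0 rhoP] := W_cont x xin' eps eps0.
  by exists rho => // y yin; apply: rhoP; rewrite /= in_itv.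
have cWG : {within `[nu, mu], continuous (fun x => (W x : R) * (G x : R))}.
  by move=> x; apply: cvgM; [exact: cW|exact: cG].
have iW : left_int (W : R -> R) nu mu (lf_int W nu mu).
  apply: lf_intP; have [l lP] := continuous_left_int hnumu cW.
  by exists l; exact/(@is_lf_intP R alpha).
have iWG : left_int (fun x => (W x : R) * (G x : R)) nu mu (lf_int (fun x => W x * G x) nu mu).
  apply: lf_intP; have [l lP] := continuous_left_int hnumu cWG.
  by exists l; exact/(@is_lf_intP R alpha).
pose S : R := supnorm W nu mu.
have WS x : nu <= x <= mu -> 0 <= (W x : R) <= S.
  move=> xin; apply/andP; split; first by apply: W_ge0; rewrite in_itv.
  have [c _ cP] := EVT_max (ltW hnumu) cW.
  apply: ub_le_sup; last by exists x => //=; rewrite in_itv.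
  by exists (W c) => _ [y /= yin <-]; exact: cP.
pose a c : R := `|D0 c| `^ q.
pose b : R := `|D0 ((nu + mu) / (2 * m))| `^ q.
pose L1 : R := lf_int (fun g => fpow alpha g * h g) 0 1.
pose L2 : R := lf_int (fun g => fpow alpha g * fpow alpha m * h (1 - g)) 0 1.
have i1 : left_int (fun g => g * (h g : R)) 0 1 L1 by exact: lf_intP h_int.
have i2 : left_int (fun g => g * m * (h (1 - g) : R)) 0 1 L2 by exact: lf_intP h_int'.
have h0 g : 0 < g < 1 -> 0 <= (h g : R) by move=> g01; apply/h_ge0/hJ; rewrite /= in_itv.
have conv c : nu <= c <= mu -> forall g, 0 < g < 1 ->
    `|D0 (g * c + (1 - g) * mid)| `^ q <= (h g : R) * a c + m * (h (1 - g) : R) * b.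
  move=> cin g g01; have /andP[g0 g1'] := g01.
  have midE : g * c + (1 - g) * mid = g * c + m * (1 - g) * ((nu + mu) / (2 * m)).
    by rewrite /mid; field; rewrite gt_eqF.
  rewrite midE; apply: G_convex.2 => //; first exact: Dnm.
  rewrite -midE; apply: Dnm.
  have g01' : 0 <= g < 1 by rewrite g1' ltW.
  by have /andP[? ?] := conv_mid_itv hnumu cin g01'; rewrite !ltW.
have nuin : nu <= nu <= mu by rewrite lexx ltW.
have muin : nu <= mu <= mu by rewrite lexx ltW.
have numid : `|nu - mid| = (mu - nu) / 2.
  rewrite (_ : nu - mid = - ((mu - nu) / 2)); last by rewrite /mid; field.
  by rewrite normrN gtr0_norm// divr_gt0// subr_gt0.
have mumid : `|mu - mid| = (mu - nu) / 2.
  rewrite (_ : mu - mid = (mu - nu) / 2); last by rewrite /mid; field.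
  by rewrite gtr0_norm// divr_gt0// subr_gt0.
have [Ln0 Bn] := half_bound hnumu nuin numid k0 hq (ltW m0) (powR_ge0 _ _) (powR_ge0 _ _)
  Gder (Gcont _ nuin) h0 (conv _ nuin) i1 i2.
have [Lm0 Bm] := half_bound hnumu muin mumid k0 hq (ltW m0) (powR_ge0 _ _) (powR_ge0 _ _)
  Gder (Gcont _ muin) h0 (conv _ muin) i1 i2.
have Wsym x : nu <= x <= mu -> (W (nu + mu - x) : R) = W x.
  by move=> xin; apply: W_sym; rewrite in_itv.
have main := trapezoid_estimate hnumu WS Wsym iW iWG Bn Bm.
have S0 : 0 <= S by have /andP[w0 /(le_trans w0)] := WS nu nuin.
have d0 : 0 < mu - nu by rewrite subr_gt0.
have r0 : 0 <= 1 - q^-1 by rewrite subr_ge0 invf_le1// (lt_le_trans ltr01).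
have AE c : (a c * L1 + b * L2) / k = a c / k * L1 + b / k * L2.
  by rewrite mulrDl ![_ * _ / k]mulrAC.
have Gc := Gamma_constant_le halpha r0.
have := trapezoid_algebra k0 hq S0 d0 Ln0 Lm0 (AE nu) (AE mu) Gc main.
rewrite /lf_I /fexp /fpow /fbase.
exact.
Qed.
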